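(* Let $\{P_i\}_{i\ge 0}\cup\{T_i\}_{i>0}\subset R$ be the sequence of jumping polynomials of $\nu$ constructed from the regular parameters $x,y,z$ of $R$ (see context), with $\beta_i=\nu(P_i)$, and $\gamma_i=\nu(T_i)$ if $T_i\ne 0$, $\gamma_i=0$ if $T_i=0$. Then $\{P_i\}_{i\ge 0}\cup\{T_i\}_{i>0}$ is a generating sequence of $\nu$ in $R$, $\Phi_R=S+U$, and $\{\beta_i\}_{i\ge 0}\cup\{\gamma_i\}_{i>0}$ generates $\Phi_R$ as a semigroup.
   Context: Setting. $k$ is an algebraically closed field, $K$ is an algebraic function field of transcendence degree 3 over $k$, and $\nu$ is a $k$-valuation of $K$ with valuation ring $(V,m_V)$, value group contained in $\mathbb{Q}$ (rational rank 1), and $V/m_V=k$. $(R,m_R)$ is a regular local ring with $k\subset R\subset K$, fraction field $K$, regular parameters $x,y,z$, dominated by $\nu$: $R\subset V$ and $R\cap m_V=m_R$. Convention: $\nu(0)=\infty$. Generating sequence. $\Phi_R=\nu(R\setminus\{0\})$; for $\sigma\in\Phi_R$, $I_\sigma=\{f\in R\mid\nu(f)\ge\sigma\}$. A (possibly infinite) family $\{Q_i\}$ of elements of $R$ is a generating sequence of $\nu$ if for every $\sigma\in\Phi_R$ the ideal $I_\sigma$ is generated by the set of all finite products $\prod_i Q_i^{b_i}$ ($b_i\in\mathbb{Z}_{\ge0}$) with $\nu(\prod_i Q_i^{b_i})\ge\sigma$. Terminology. Monomials are formal monomials in the symbols $P_j,T_j$. A monomial $x_1^{a_1}\cdots x_k^{a_k}$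 is irreducible with respect to a set $\mathcal{X}$ of monomials if $x_1^{b_1}\cdots x_k^{b_k}\notin\mathcal{X}$ for all integers $0\le b_i\le a_i$. If $\Phi$ is a semigroup with fixed generators $\mu_1,\dots,\mu_k$ and $\mu\in\Phi+(-\Phi)$, a tuple $(a_1,\dots,a_k,a)$ with $a_i\in\mathbb{Z}_{\ge0}$, $a\in\mathbb{Z}_{>0}$ is reduced with respect to $(\Phi,\mu)$ if $\sum a_i\mu_i+a\mu\in\Phi$ and $\sum b_i\mu_i+b\mu\notin\Phi$ for all integers $0<b\le a$, $0\le b_i\le a_i$ with $\sum b_i+b<\sum a_i+a$. Construction of the $P_i$. $P_0=x$, $P_1=y$, $\mathcal{P}_0=\mathcal{P}_1=\emptyset$. For $i\ge0$: $\beta_i=\nu(P_i)$, $G_i=\sum_{j=0}^i\beta_j\mathbb{Z}$, $S_i=\sum_{j=0}^i\beta_j\mathbb{Z}_{\ge0}$. For $i>0$: $q_i=\min\{q\in\mathbb{Z}_{>0}\mid q\beta_i\in G_{i-1}\}$, $\mathcal{P}_{i+1}=\mathcal{P}_i\cup\{P_i^{q_i}\}$; $n_{i,0},\dots,n_{i,i-1}\in\mathbb{Z}_{\ge0}$ are the (unique) integers with $q_i\beta_i=\sum_{j=0}^{i-1}n_{i,j}\beta_j$ and $\prod_{j=0}^{i-1}P_j^{n_{i,j}}$ irreducible with respect to $\mathcal{P}_i$ (i.e. $n_{i,j}<q_j$ for $j>0$); $\lambda_i\in k\setminus\{0\}$ is the residue of $P_i^{q_i}/\prod_{j=0}^{i-1}P_j^{n_{i,j}}$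 in $V/m_V=k$; and $P_{i+1}=P_i^{q_i}-\lambda_i\prod_{j=0}^{i-1}P_j^{n_{i,j}}$. Set $G=\bigcup G_i$, $S=\bigcup S_i$, $\mathcal{P}=\bigcup\mathcal{P}_i$. Construction of the $T_i$. $T_1=z$, $m_0=0$, $\delta_0=1$, $\mathcal{T}_1=\mathcal{P}$, $H_0=U_0=\{0\}$. For $i>0$ with $T_i\ne0$: $\gamma_i=\nu(T_i)$, $H_i=\sum_{j=1}^i\gamma_j\mathbb{Z}$, $U_i=\sum_{j=1}^i\gamma_j\mathbb{Z}_{\ge0}$, $s_i=\min\{s\in\mathbb{Z}_{>0}\mid s\gamma_i\in H_{i-1}+G\}$, $m_i=\max(m_{i-1},\min\{j\in\mathbb{Z}_{\ge0}\mid s_i\gamma_i\in H_{i-1}+G_j\})$. Let $\mathcal{D}_i$ be the set of tuples $\bar d=(a_0,\dots,a_{m_i},c_1,\dots,c_{i-1},c_i)\in(\mathbb{Z}_{\ge0})^{m_i+1+i}$ with $c_i>0$ such that $\bar d$ is reduced with respect to $(S_{m_i}+U_{i-1},\,s_i\gamma_i)$ (generators $\beta_0,\dots,\beta_{m_i},\gamma_1,\dots,\gamma_{i-1}$) and $\prod_{j=0}^{m_i}P_j^{a_j}\prod_{j=1}^{i-1}T_j^{c_j}$ is irreducible with respect to $\mathcal{T}_i$. Put $\delta_i=\#\mathcal{D}_i$ (which is finite), $\mathcal{T}_{i+1}=\mathcal{T}_i\cup\{T_i^{c_is_i}\prod_{j=0}^{m_i}P_j^{a_j}\prod_{j=1}^{i-1}T_j^{c_j}\mid\bar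 d\in\mathcal{D}_i\}$, $|\bar d|=\sum_{j=0}^{m_i}a_j\beta_j+\sum_{j=1}^{i-1}c_j\gamma_j+c_is_i\gamma_i$, and order $\mathcal{D}_i=\{\bar d_1,\dots,\bar d_{\delta_i}\}$ with $|\bar d_1|\le\dots\le|\bar d_{\delta_i}|$. For $\bar d=\bar d_k$ let $n_{\bar d,0},\dots,n_{\bar d,m_i},l_{\bar d,1},\dots,l_{\bar d,i-1}\in\mathbb{Z}_{\ge0}$ be the (unique) integers with $|\bar d|=\sum_{j=0}^{m_i}n_{\bar d,j}\beta_j+\sum_{j=1}^{i-1}l_{\bar d,j}\gamma_j$ and $\prod_{j=0}^{m_i}P_j^{n_{\bar d,j}}\prod_{j=1}^{i-1}T_j^{l_{\bar d,j}}$ irreducible with respect to $\mathcal{T}_i$; let $\mu_{\bar d}\in k\setminus\{0\}$ be the residue in $V/m_V$ of $\bigl(T_i^{c_is_i}\prod_{j=0}^{m_i}P_j^{a_j}\prod_{j=1}^{i-1}T_j^{c_j}\bigr)/\bigl(\prod_{j=0}^{m_i}P_j^{n_{\bar d,j}}\prod_{j=1}^{i-1}T_j^{l_{\bar d,j}}\bigr)$, and set $$T_{(\sum_{j=0}^{i-1}\delta_j)+k}=T_{\bar d}=T_i^{c_is_i}\prod_{j=0}^{m_i}P_j^{a_j}\prod_{j=1}^{i-1}T_j^{c_j}-\mu_{\bar d}\prod_{j=0}^{m_i}P_j^{n_{\bar d,j}}\prod_{j=1}^{i-1}T_j^{l_{\bar d,j}}.$$ For $i>0$ with $T_i=0$: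 $\gamma_i=0$, $H_i=H_{i-1}$, $U_i=U_{i-1}$, $s_i=1$, $m_i=m_{i-1}$, $\mathcal{D}_i=\emptyset$, $\delta_i=0$, $\mathcal{T}_{i+1}=\mathcal{T}_i\cup\{T_i\}$. Set $H=\bigcup H_i$, $U=\bigcup U_i$, $\mathcal{T}=\bigcup\mathcal{T}_i$. The elements of $\{P_i\}_{i\ge0}\cup\{T_i\}_{i>0}$ are called jumping polynomials. *)

(* Defs.v *)
From HB Require Import structures.
From mathcomp Require Import all_boot all_order all_algebra.
From mathcomp Require Import finmap.
From mathcomp Require Import monalg.
From mathcomp Require Import mpoly.
From mathcomp Require Import classical_sets.

Set Implicit Arguments.
Unset Strict Implicit.
Unset Printing Implicit Defensive.

Import Order.TTheory GRing.Theory Num.Theory.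
Local Open Scope classical_set_scope.
Local Open Scope ring_scope.

Section Extensions.
Variables (k K : fieldType) (iota : {rmorphism k -> K}).

Definition eval_at n (t : 'I_n -> K) (p : mpoly n k) : K :=
  mmap iota t p.

Definition alg_independent n (t : 'I_n -> K) : Prop :=
  forall p, eval_at t p = 0 -> p = 0.

(* [a] is algebraic over the field [k(t)]; the denominators have been cleared
   from the coefficients of the polynomial. *)
Definition algebraic_over_gen n (t : 'I_n -> K) (a : K) : Prop :=
  exists2 p : {poly (mpoly n k)},
    map_poly (eval_at t) p != 0 & root (map_poly (eval_at t) p) a.

Definition transcendence_degree n : Prop :=
  exists2 t : 'I_n -> K, alg_independent t & forall a, algebraic_over_gen t a.

Definition fin_gen_field : Prop :=
  exists (n : nat) (t : 'I_n -> K), forall a : K,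
    exists p q, eval_at t q != 0 /\ a = eval_at t p / eval_at t q.

Definition algebraic_function_field n : Prop :=
  fin_gen_field /\ transcendence_degree n.

End Extensions.

(* Rings between [k] and [K] and their ideals are subsets of [K]. *)
Section Rings.
Variable K : fieldType.
Implicit Types R I M : set K.

Definition subring R : Prop :=
  [/\ R 1, forall a b, R a -> R b -> R (a - b)
    & forall a b, R a -> R b -> R (a * b)].

Definition fraction_field R : Prop :=
  forall a : K, exists f g, [/\ R f, R g, g != 0 & a = f / g].

Definition ideal R I : Prop :=
  [/\ I `<=` R, I 0, forall a b, I a -> I b -> I (a + b)
    & forall r a, R r -> I a -> I (r * a)].

Definition ideal_gen R (A : set K) : set K :=
  [set f | exists (n : nat) (r g : 'I_n -> K),
     (forall i, R (r i) /\ A (g i)) /\ f = \sum_i r i * g i].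

Definition prime_ideal R I : Prop :=
  [/\ ideal R I, ~ I 1
    & forall a b, R a -> R b -> I (a * b) -> I a \/ I b].

Definition maximal_ideal R M : Prop :=
  [/\ ideal R M, M <> R
    & forall I, ideal R I -> M `<=` I -> I <> R -> I = M].

Definition noetherian R : Prop :=
  forall I, ideal R I -> exists s : seq K, I = ideal_gen R [set a | a \in s].

Definition local_ring R M : Prop :=
  maximal_ideal R M /\ forall N, maximal_ideal R N -> N = M.

Definition prime_chain R n (p : nat -> set K) : Prop :=
  (forall i, (i <= n)%N -> prime_ideal R (p i)) /\
  (forall i, (i < n)%N -> p i `<` p i.+1).

Definition krull_dim R n : Prop :=
  (exists p, prime_chain R n p) /\ (forall p, ~ prime_chain R n.+1 p).

(* [R] is a regular local ring of dimension [n] with maximal ideal [M] and [t]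
   is a regular system of parameters. *)
Definition regular_local_ring R M n (t : n.-tuple K) : Prop :=
  [/\ subring R, noetherian R, local_ring R M, krull_dim R n
    & (forall a, a \in t -> R a) /\ M = ideal_gen R [set a | a \in t]].

End Rings.

(* The value [nu 0] is meaningless: the convention [nu 0 = +oo] is built into
   [vge] and [vgt]. *)
Section Valuations.
Variables (k K : fieldType) (iota : {rmorphism k -> K}) (nu : K -> rat).

Definition vge (f : K) (sigma : rat) : Prop := f = 0 \/ sigma <= nu f.
Definition vgt (f : K) (sigma : rat) : Prop := f = 0 \/ sigma < nu f.

Definition is_valuation : Prop :=
  [/\ forall a b, a != 0 -> b != 0 -> nu (a * b) = nu a + nu b,
      forall a b, a != 0 -> b != 0 -> a + b != 0 ->
        Num.min (nu a) (nu b) <= nu (a + b)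
    & forall c : k, c != 0 -> nu (iota c) = 0].

Definition val_ring : set K := [set f | vge f 0].
Definition val_max : set K := [set f | vgt f 0].

(* The residue of [f] is the class of [c]. *)
Definition residue_is (f : K) (c : k) : Prop :=
  val_ring f /\ val_max (f - iota c).

Definition residue_field_is_base : Prop :=
  forall f, val_ring f -> exists c : k, residue_is f c.

Definition dominates (R M : set K) : Prop :=
  R `<=` val_ring /\ R `&` val_max = M.

Definition value_semigroup (R : set K) : set rat :=
  [set s | exists f, [/\ R f, f != 0 & s = nu f]].

Definition val_ideal (R : set K) (sigma : rat) : set K :=
  [set f | R f /\ vge f sigma].

End Valuations.

(* Formal monomials in a family of symbols are the [{cmonom I}] of [monalg]. *)
Section Monomials.
Variable I : choiceType.
Implicit Types (m b : {cmonom I}) (X : set ({cmonom I})).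

Definition mono_eval (K : comNzRingType) (h : I -> K) m : K :=
  \prod_(u <- finsupp m) h u ^+ m u.

Definition mono_weight (w : I -> rat) m : rat :=
  \sum_(u <- finsupp m) w u *+ m u.

Definition mono_le b m : Prop := forall u, (b u <= m u)%N.

Definition mono_mulXn (u : I) (e : nat) m : {cmonom I} :=
  monalg.mmul (monalg.expcmn (monalg.ucm u) e) m.

Definition irreducible_wrt X m : Prop := forall b, mono_le b m -> ~ X b.

(* The tuple [(a_1, .., a_k, a)] is given as a monomial and a natural number;
   the generator of [Phi] attached to the symbol [u] is [w u]. *)
Definition reduced (w : I -> rat) (Phi : set rat) (mu : rat)
    (d : {cmonom I} * nat) : Prop :=
  Phi (mono_weight w d.1 + mu *+ d.2) /\
  forall b e, (0 < e <= d.2)%N -> mono_le b d.1 ->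
    (monalg.mdeg b + e < monalg.mdeg d.1 + d.2)%N ->
    ~ Phi (mono_weight w b + mu *+ e).

End Monomials.

Section GeneratingSequences.
Variables (K : fieldType) (nu : K -> rat) (R : set K).

Definition generating_sequence (I : choiceType) (Q : I -> K) : Prop :=
  (forall i, R (Q i)) /\
  forall sigma, value_semigroup nu R sigma ->
    val_ideal nu R sigma =
    ideal_gen R [set f | exists b : {cmonom I},
                   f = mono_eval Q b /\ vge nu f sigma].

End GeneratingSequences.

Section Spans.
Implicit Types (w : nat -> rat) (A B : set rat).

Definition zspan n w : set rat :=
  [set g | exists c : 'I_n -> int, g = \sum_(j < n) w j *~ c j].

Definition nspan n w : set rat :=
  [set g | exists c : 'I_n -> nat, g = \sum_(j < n) w j *+ c j].

Definition sumset A B : set rat :=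
  [set g | exists a b, [/\ A a, B b & g = a + b]].

(* Semigroups contain 0, as value semigroups do. *)
Definition semigroup_gen A : set rat :=
  [set g | exists2 s : seq rat, (forall a, a \in s -> A a) & g = \sum_(a <- s) a].

Definition is_least (A : set nat) (n : nat) : Prop :=
  A n /\ forall j, A j -> (n <= j)%N.

End Spans.

(* [inl j] is the symbol P_j and [inr j], for [0 < j], is the symbol T_j. *)
Definition symb : choiceType := (nat + nat)%type.
Notation mono := ({cmonom symb}).

Section JumpingPolynomials.
Variables (k K : fieldType) (iota : {rmorphism k -> K}) (nu : K -> rat).
Variables (x y z : K).
(* Indices are the customary ones: P_0, P_1, .. and T_1, T_2, ..; the value
   [T 0] is never used. *)
Variables P T : nat -> K.

Definition jbeta (i : nat) : rat := nu (P i).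
Definition jgamma (i : nat) : rat := if T i == 0 then 0 else nu (T i).

Definition jG i := zspan i.+1 jbeta.
Definition jS i := nspan i.+1 jbeta.
Definition jH i := zspan i (fun j => jgamma j.+1).
Definition jU i := nspan i (fun j => jgamma j.+1).
Definition jGall : set rat := \bigcup_i jG i.
Definition jSall : set rat := \bigcup_i jS i.
Definition jUall : set rat := \bigcup_i jU i.

Definition jpoly (u : symb) : K :=
  match u with inl j => P j | inr j => T j end.
Definition jweight (u : symb) : rat :=
  match u with inl j => jbeta j | inr j => jgamma j end.

(* [m] is a monomial in P_0, .., P_(a-1) and T_1, .., T_(b-1). *)
Definition mono_in (a b : nat) (m : mono) : Prop :=
  forall u : symb, u \in finsupp m ->
    match u with inl j => (j < a)%N | inr j => (0 < j < b)%N end.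

Section Construction.
Variables (q : nat -> nat) (n : nat -> mono) (lam : nat -> k).

Definition Pset (i : nat) : set mono :=
  [set m | exists2 j, (0 < j < i)%N & m = mono_mulXn (inl j) (q j) (monalg.onecm _)].
Definition Psetall : set mono := \bigcup_i Pset i.

Definition P_step (i : nat) : Prop :=
  [/\ is_least [set e | (0 < e)%N /\ jG i.-1 (jbeta i *+ e)] (q i),
      [/\ mono_in i 0 (n i), jbeta i *+ q i = mono_weight jweight (n i)
        & irreducible_wrt (Pset i) (n i)],
      lam i != 0 /\ residue_is iota nu (P i ^+ q i / mono_eval jpoly (n i)) (lam i)
    & P i.+1 = P i ^+ q i - iota (lam i) * mono_eval jpoly (n i)].

Definition P_construction : Prop :=
  [/\ P 0%N = x, P 1%N = y & forall i, (0 < i)%N -> P_step i].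

(* An element [(w, c)] of [D i] is the tuple [(a_0, .., a_(m_i), c_1, .., c_i)]
   with [c = c_i] and [w] the monomial in the P_j and the T_j, [j < i], whose
   exponents are the other entries. *)
Variables (s m : nat -> nat) (D : nat -> seq (mono * nat)).
Variables (l : nat -> mono * nat -> mono) (mu : nat -> mono * nat -> k).

Definition jdelta (i : nat) : nat := (if i == 0 then 1 else size (D i))%N.

Definition tuple_mono (i : nat) (d : mono * nat) : mono :=
  mono_mulXn (inr i) (d.2 * s i)%N d.1.
Definition tuple_weight (i : nat) (d : mono * nat) : rat :=
  mono_weight jweight d.1 + jgamma i *+ (d.2 * s i)%N.

Definition Tset (i : nat) : set mono :=
  [set w | Psetall w \/ exists2 j, (0 < j < i)%N &
     if T j == 0 then w = monalg.ucm (inr j)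
     else exists2 d, d \in D j & w = tuple_mono j d].

Definition D_spec (i : nat) (d : mono * nat) : Prop :=
  [/\ mono_in (m i).+1 i d.1, (0 < d.2)%N,
      reduced jweight (sumset (jS (m i)) (jU i.-1)) (jgamma i *+ s i) d
    & irreducible_wrt (Tset i) d.1].

Definition T_step (i : nat) : Prop :=
  [/\ is_least [set e | (0 < e)%N /\ sumset (jH i.-1) jGall (jgamma i *+ e)] (s i),
      exists2 j, is_least [set j | sumset (jH i.-1) (jG j) (jgamma i *+ s i)] j
        & m i = maxn (m i.-1) j,
      [/\ uniq (D i), forall d, d \in D i <-> D_spec i d
        & sorted (fun d e => tuple_weight i d <= tuple_weight i e) (D i)],
      forall d, d \in D i ->
        [/\ mono_in (m i).+1 i (l i d),
            tuple_weight i d = mono_weight jweight (l i d),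
            irreducible_wrt (Tset i) (l i d),
            mu i d != 0
          & residue_is iota nu
              (mono_eval jpoly (tuple_mono i d) / mono_eval jpoly (l i d)) (mu i d)]
    & forall e, (e < size (D i))%N ->
        let d := nth (monalg.onecm _, 0%N) (D i) e in
        T (\sum_(j < i) jdelta j + e.+1)%N =
          mono_eval jpoly (tuple_mono i d) - iota (mu i d) * mono_eval jpoly (l i d)].

Definition T_step_zero (i : nat) : Prop :=
  [/\ s i = 1%N, m i = m i.-1 & D i = [::]].

(* The stages before [i] produce T_1, .., T_r with [r = \sum_(j < i) jdelta j].
   If [r < i], the construction has stopped and T_i does not exist; the
   sequence is then prolonged by 0, which adds nothing to the ideals and
   semigroups generated. *)
Definition T_construction : Prop :=
  [/\ T 1%N = z, m 0%N = 0%N,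
      forall i, (0 < i)%N -> T i != 0 -> T_step i,
      forall i, (0 < i)%N -> T i = 0 -> T_step_zero i
    & forall i, (0 < i)%N -> ((\sum_(j < i) jdelta j) < i)%N -> T i = 0].

End Construction.

Definition jumping_polynomials : Prop :=
  exists q n lam, P_construction q n lam /\
  exists s m D l mu, T_construction q s m D l mu.

(* The family P_0, P_1, .., T_1, T_2, .. *)
Definition jumping_family (u : symb) : K :=
  match u with inl j => P j | inr j => T j.+1 end.

End JumpingPolynomials.

(* Main.v *)
Require Import Defs.
From mathcomp Require Import all_boot all_order all_algebra.
From mathcomp Require Import finmap monalg.
From mathcomp Require Import boolp classical_sets.
From mathcomp Require Import ring lra zify.

(** Everything follows from a normal form theorem. Fix a bound [sigma] and let
    [J] be the ideal of [R] generated by the monomials in the [P_j] and [T_j] of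
    value at least [sigma]. Every [f] in [R] is congruent modulo [J] to a
    [k]-linear combination of irreducible monomials, and irreducible monomials
    have distinct values. No cancellation is therefore possible in such a
    combination: its value is the least value of its terms. If [nu f >= sigma],
    all the terms lie in [J], and so does [f]; this is the generation of the
    ideals. If [sigma > nu f], then [nu f] is the value of one of the terms,
    hence a sum of [beta_j] and [gamma_j].

    Existence ([normal_form]). The residue field is [k], so that
    [f = c + f1 x + f2 y + f3 z] with [c] in [k]. Iterating this, [f] becomes a
    polynomial in [x = P_0], [y = P_1], [z = T_1] up to multiples of monomials of
    large degree, which belong to [J]. It remains to reduce a monomial
    ([monomial_normal_form]). A reducible monomial is divisible by the leading
    monomial of some jumping polynomial ([reduction]); substituting for it gives
    a monomial of larger value (or zero) and a monomial of the same value which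
    involves earlier symbols. The second kind decreases a suitable rank
    ([exists_rank]), and the first kind can occur only finitely often because
    [R] has finitely many values below [sigma] ([finitely_many_values]): modulo
    the elements of value at least [sigma], [R] is spanned by finitely many
    vectors, each of which accounts for at most one value.

    Uniqueness ([irreducible_weight_inj]). Suppose two irreducible monomials have
    the same value, and let [T_i] be the last of the [T_j] in which they differ.
    The difference of the exponents is a multiple [e s_i] of [s_i]. The group
    [H_(i-1) + G_(m_i)] meets [G] in [G_(m_i)] only ([HG_cap_G]), and exponents
    of the [P_j] less than [q_j] are the digits of an element of [G]
    ([beta_digits]), so the two monomials agree in the [P_j] with [j > m_i].
    After cancellation, the [P_j], [j <= m_i], and [T_j], [j < i], of the larger
    monomial form together with [e] a tuple whose value lies in
    [S_(m_i) + U_(i-1)]. Below it there is a reduced tuple, that is, an element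
    of [D_i], and the larger monomial was reducible ([no_collision]). *)

Set Implicit Arguments.
Unset Strict Implicit.
Unset Printing Implicit Defensive.

Import Order.TTheory GRing.Theory Num.Theory.
Local Open Scope classical_set_scope.
Local Open Scope ring_scope.
Local Open Scope monom_scope.
Local Open Scope ring_scope.

(** * Formal monomials *)

Section Monomials.
Variable I : choiceType.
Implicit Types (m : {cmonom I}) (u v : I).

Lemma mono_ext m1 m2 : (forall u, m1 u = m2 u) -> m1 = m2.
Proof. by move=> h; apply/eqP/monalg.cmP. Qed.

Lemma mmulE m1 m2 u : monalg.mmul m1 m2 u = (m1 u + m2 u)%N.
Proof. exact: monalg.mulcmE. Qed.

Lemma mono_mulXnE u e m v : mono_mulXn u e m v = ((u == v) * e + m v)%N.
Proof.
rewrite /mono_mulXn mmulE; congr addn; rewrite /monalg.expcmn.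
case: e => [|e]; first by rewrite muln0 monalg.onecmE.
elim: e => [|e IH]; first by rewrite muln1 monalg.ucmE.
rewrite (iteropS (monalg.onecm I)) iterS -(iteropS (monalg.onecm I)).
by rewrite monalg.mulcmE IH monalg.ucmE -mulnS.
Qed.

Lemma mono_leK (b : {cmonom I}) m : mono_le b m -> m = monalg.mmul b (monalg.divcm m b).
Proof.
by move=> le_bm; apply: mono_ext => u; rewrite mmulE monalg.divcmE subnKC.
Qed.

Lemma mono_finsuppP u m : (u \in finsupp m) = (m u != 0)%N.
Proof. by rewrite monalg.cmE_neq0. Qed.

(** [mono_eval], [mono_weight] and [mono_rank] are all iterated operations over
    the support of a monomial; what they share is proved once for a family [F]
    of functions of the exponents. *)
Lemma mono_big_widen (A : Type) (idx : A) (op : Monoid.com_law idx)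
    (F : I -> nat -> A) (r : seq I) m :
    (forall u, F u 0%N = idx) -> uniq r -> {subset finsupp m <= r} ->
  \big[op/idx]_(u <- finsupp m) F u (m u) = \big[op/idx]_(u <- r) F u (m u).
Proof.
move=> F0 ur sub; rewrite [RHS](bigID (fun u => m u != 0%N)) /=.
rewrite [X in op _ X]big1 => [|u /negbNE/eqP -> //].
rewrite Monoid.mulm1 -[RHS]big_filter; apply: perm_big.
apply: uniq_perm; rewrite ?fset_uniq ?filter_uniq // => u.
by rewrite mem_filter -mono_finsuppP; case: (boolP (_ \in finsupp m)) => // /sub ->.
Qed.

Lemma mono_big_mul (A : Type) (idx : A) (op : Monoid.com_law idx)
    (F : I -> nat -> A) m1 m2 :
    (forall u, F u 0%N = idx) ->
    (forall u a b, F u (a + b)%N = op (F u a) (F u b)) ->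
  \big[op/idx]_(u <- finsupp (monalg.mmul m1 m2)) F u (monalg.mmul m1 m2 u) =
  op (\big[op/idx]_(u <- finsupp m1) F u (m1 u))
     (\big[op/idx]_(u <- finsupp m2) F u (m2 u)).
Proof.
move=> F0 FD; pose S := (finsupp m1 `|` finsupp m2)%fset.
rewrite !(@mono_big_widen _ _ _ F S) ?fset_uniq //.
- by rewrite -big_split; apply: eq_bigr => u _; rewrite mmulE FD.
- by move=> u um; rewrite in_fsetU um orbT.
- by move=> u um; rewrite in_fsetU um.
- by move=> u; rewrite in_fsetU !mono_finsuppP mmulE addn_eq0 negb_and.
Qed.

Lemma mono_big_one (A : Type) (idx : A) (op : Monoid.com_law idx)
    (F : I -> nat -> A) : (forall u, F u 0%N = idx) ->
  \big[op/idx]_(u <- finsupp (monalg.onecm I)) F u (monalg.onecm I u) = idx.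
Proof. by move=> F0; rewrite big1 // => u _; rewrite monalg.onecmE. Qed.

Lemma mono_big_pow (A : Type) (idx : A) (op : Monoid.com_law idx)
    (F : I -> nat -> A) u e m :
    (forall u, F u 0%N = idx) ->
    (forall u a b, F u (a + b)%N = op (F u a) (F u b)) ->
  \big[op/idx]_(v <- finsupp (mono_mulXn u e m)) F v (mono_mulXn u e m v) =
  op (F u e) (\big[op/idx]_(v <- finsupp m) F v (m v)).
Proof.
move=> F0 FD; rewrite mono_big_mul //; congr (op _ _).
rewrite (@mono_big_widen _ _ _ F [:: u]) //.
  rewrite big_seq1; congr F.
  by have := mono_mulXnE u e (monalg.onecm I) u;
     rewrite eqxx mul1n mmulE monalg.onecmE !addn0.
move=> v; rewrite mono_finsuppP mem_seq1.
have := mono_mulXnE u e (monalg.onecm I) v; rewrite mmulE monalg.onecmE !addn0.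
by move=> ->; case: (eqVneq u v) => [_ _|_] //; rewrite ?mul0n.
Qed.

Lemma mono_eval_mul (K : comNzRingType) (h : I -> K) m1 m2 :
  mono_eval h (monalg.mmul m1 m2) = mono_eval h m1 * mono_eval h m2.
Proof. by apply: (@mono_big_mul _ _ _ (fun u a => h u ^+ a)) => *; rewrite ?exprD. Qed.

Lemma mono_eval_one (K : comNzRingType) (h : I -> K) :
  mono_eval h (monalg.onecm I) = 1.
Proof. exact: (@mono_big_one _ _ _ (fun u a => h u ^+ a)). Qed.

Lemma mono_eval_mulXn (K : comNzRingType) (h : I -> K) u e m :
  mono_eval h (mono_mulXn u e m) = h u ^+ e * mono_eval h m.
Proof. by apply: (@mono_big_pow _ _ _ (fun u a => h u ^+ a)) => *; rewrite ?exprD. Qed.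

Lemma mono_weight_mul (w : I -> rat) m1 m2 :
  mono_weight w (monalg.mmul m1 m2) = mono_weight w m1 + mono_weight w m2.
Proof. by apply: (@mono_big_mul _ _ _ (fun u a => w u *+ a)) => *; rewrite ?mulrnDr. Qed.

Lemma mono_weight_one (w : I -> rat) : mono_weight w (monalg.onecm I) = 0.
Proof. exact: (@mono_big_one _ _ _ (fun u a => w u *+ a)). Qed.

Lemma mono_weight_mulXn (w : I -> rat) u e m :
  mono_weight w (mono_mulXn u e m) = w u *+ e + mono_weight w m.
Proof. by apply: (@mono_big_pow _ _ _ (fun u a => w u *+ a)) => *; rewrite ?mulrnDr. Qed.

(** A weight with values in [nat], used to prove that rewriting terminates. *)
Definition mono_rank (r : I -> nat) m : nat := (\sum_(u <- finsupp m) r u * m u)%N.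

Lemma mono_rank_mul (r : I -> nat) m1 m2 :
  mono_rank r (monalg.mmul m1 m2) = (mono_rank r m1 + mono_rank r m2)%N.
Proof.
by apply: (@mono_big_mul _ _ _ (fun u a => (r u * a)%N)) => *; rewrite ?mulnDr ?muln0.
Qed.

Lemma mono_rank_mulXn (r : I -> nat) u e m :
  mono_rank r (mono_mulXn u e m) = (r u * e + mono_rank r m)%N.
Proof.
by apply: (@mono_big_pow _ _ _ (fun u a => (r u * a)%N)) => *; rewrite ?mulnDr ?muln0.
Qed.

Lemma eq_mono_rank (r r' : I -> nat) m :
  {in finsupp m, r =1 r'} -> mono_rank r m = mono_rank r' m.
Proof. by move=> e; apply: eq_big_seq => u um; rewrite e. Qed.

Lemma mono_eval_neq0 (K : fieldType) (h : I -> K) m :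
  mono_eval h m != 0 <-> forall u, m u != 0%N -> h u != 0.
Proof.
rewrite /mono_eval prodf_seq_neq0 /=; split=> [/allP H u mu | H].
  apply: contraNneq (H u _) => [->|]; last by rewrite mono_finsuppP.
  by rewrite expr0n (negPf mu).
by apply/allP => u; rewrite mono_finsuppP => mu; rewrite expf_neq0 ?H.
Qed.

Definition mono_restr (p : pred I) m : {cmonom I} :=
  [cmonom if p u then m u else 0 | u in finsupp m]%M.

Lemma mono_restrE p m u : mono_restr p m u = if p u then m u else 0%N.
Proof.
rewrite /mono_restr monalg.cmE fsfunE mono_finsuppP.
by case: eqP => [->|//]; case: (p u).
Qed.

(** Among the tuples below a given one whose value lies in [Phi], one of least
    degree is reduced. *)
Lemma reduced_below (w : I -> rat) (Phi : set rat) (g : rat) m e :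
    (0 < e)%N -> Phi (mono_weight w m + g *+ e) ->
  exists b e', [/\ mono_le b m, (0 < e' <= e)%N & reduced w Phi g (b, e')].
Proof.
move: {2}(monalg.mdeg m + e)%N (leqnn (monalg.mdeg m + e)) => N.
elim: N m e => [|N IH] m e le_N e0 hm.
  by move: le_N; rewrite leqn0 addn_eq0 => /andP[_ /eqP e00]; rewrite e00 in e0.
have [hr|nr] := pselect (reduced w Phi g (m, e)).
  by exists m, e; split; rewrite ?e0 ?leqnn.
have [b [e' [le_e le_b lt_d hb]]] : exists b e', [/\ (0 < e' <= e)%N, mono_le b m,
    (monalg.mdeg b + e' < monalg.mdeg m + e)%N & Phi (mono_weight w b + g *+ e')].
  apply: contrapT => no; apply: nr; split=> //= b e' h1 h2 h3 h4.
  by apply: no; exists b, e'.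
have [e'0 e'e] := andP le_e.
have [|||b1 [e1 [le1 /andP[e10 e11] hr]]] := IH b e' => //.
  by rewrite -ltnS; apply: leq_trans lt_d le_N.
exists b1, e1; split=> //; first by move=> u; apply: leq_trans (le_b u).
by rewrite e10 (leq_trans e11 e'e).
Qed.

End Monomials.

(** * Valuations *)

Section Valuations.
Variables (k K : fieldType) (iota : {rmorphism k -> K}) (nu : K -> rat).
Hypothesis hnu : is_valuation iota nu.
Implicit Types (a b f g : K) (s t : rat).

Lemma nuM a b : a != 0 -> b != 0 -> nu (a * b) = nu a + nu b.
Proof. by case: hnu => H _ _; apply: H. Qed.

Lemma nu_iota c : c != 0 -> nu (iota c) = 0.
Proof. by case: hnu => _ _ H; apply: H. Qed.

Lemma nu1 : nu 1 = 0.
Proof. by rewrite -(rmorph1 iota) nu_iota ?oner_neq0. Qed.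

Lemma nuN a : nu (- a) = nu a.
Proof.
have [->|a0] := eqVneq a 0; first by rewrite oppr0.
have i1 : iota (-1) = -1 by rewrite rmorphN1.
by rewrite -mulN1r -i1 nuM ?fmorph_eq0 ?oppr_eq0 ?oner_neq0 // nu_iota
  ?add0r // oppr_eq0 oner_neq0.
Qed.

Lemma nuX a n : a != 0 -> nu (a ^+ n) = nu a *+ n.
Proof.
move=> a0; elim: n => [|n IH]; first by rewrite expr0 nu1.
by rewrite exprS nuM ?expf_neq0 // IH mulrS.
Qed.

Lemma nu_iotaM c a : c != 0 -> nu (iota c * a) = nu a.
Proof.
move=> c0; have [->|a0] := eqVneq a 0; first by rewrite mulr0.
by rewrite nuM ?fmorph_eq0 // nu_iota // add0r.
Qed.

Lemma vgeD a b s : vge nu a s -> vge nu b s -> vge nu (a + b) s.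
Proof.
move=> [->|ha] [->|hb]; rewrite ?addr0 ?add0r; try by [left|right].
have [->|a0] := eqVneq a 0; first by rewrite add0r; right.
have [->|b0] := eqVneq b 0; first by rewrite addr0; right.
have [->|ab0] := eqVneq (a + b) 0; first by left.
right; case: hnu => _ H _; apply: le_trans (H _ _ a0 b0 ab0).
by rewrite le_min ha hb.
Qed.

Lemma vgeM a b s t : vge nu a s -> vge nu b t -> vge nu (a * b) (s + t).
Proof.
have [->|a0] := eqVneq a 0; first by rewrite mul0r; left.
have [->|b0] := eqVneq b 0; first by rewrite mulr0; left.
move=> [/eqP|ha]; first by rewrite (negPf a0).
move=> [/eqP|hb]; first by rewrite (negPf b0).
by right; rewrite nuM // lerD.
Qed.

Lemma vge_iotaM c a s : vge nu a s -> vge nu (iota c * a) s.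
Proof.
have [->|c0] := eqVneq c 0; first by rewrite rmorph0 mul0r; left.
by case=> [->|h]; [left; rewrite mulr0|right; rewrite nu_iotaM].
Qed.

Lemma vge_sum n (F : 'I_n -> K) s :
  (forall i, vge nu (F i) s) -> vge nu (\sum_i F i) s.
Proof. by move=> H; elim/big_ind: _ => [|a b|i _] //; [left|exact: vgeD]. Qed.

Lemma nu_add_lt a b : a != 0 -> b != 0 -> nu a < nu b ->
  a + b != 0 /\ nu (a + b) = nu a.
Proof.
move=> a0 b0 lt_ab; case: hnu => _ H _.
have ab0 : a + b != 0.
  by apply: contraTneq lt_ab => /eqP; rewrite addr_eq0 => /eqP ->;
     rewrite nuN ltxx.
split=> //; apply/le_anti/andP; split; last first.
  by apply: le_trans (H _ _ a0 b0 ab0); rewrite le_min lexx ltW.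
have nb0 : - b != 0 by rewrite oppr_eq0.
have := H _ _ ab0 nb0; rewrite addrK nuN => /(_ a0).
by rewrite ge_min => /orP[//|]; rewrite leNgt lt_ab.
Qed.

Lemma nu_add_vgt a b : a != 0 -> vgt nu b (nu a) ->
  a + b != 0 /\ nu (a + b) = nu a.
Proof.
move=> a0 [->|h]; first by rewrite addr0.
have [->|b0] := eqVneq b 0; first by rewrite addr0.
exact: nu_add_lt.
Qed.

(** No cancellation can occur in a sum of elements of distinct values. *)
Lemma nu_sum (J : eqType) (F : J -> K) (r : seq J) :
    uniq r -> (forall i, i \in r -> F i != 0) ->
    {in r &, injective (nu \o F)} -> r != [::] ->
  exists i, [/\ i \in r, \sum_(j <- r) F j != 0,
    nu (\sum_(j <- r) F j) = nu (F i) & forall j, j \in r -> nu (F i) <= nu (F j)].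
Proof.
elim: r => [//|i r IH] /= /andP[ir ur] F0 inj _; rewrite big_cons.
have [-> | r0] := eqVneq r [::].
  exists i; rewrite big_nil addr0 mem_head; split=> //; first exact/F0/mem_head.
  by move=> j; rewrite inE => /eqP ->.
have Fi0 : F i != 0 by apply/F0/mem_head.
have [| |j [jr S0 eS le_j]] := IH ur _ _ r0.
- by move=> j jr; apply: F0; rewrite inE jr orbT.
- by move=> j l jr lr; apply: inj; rewrite inE ?jr ?lr orbT.
have [lt|lt|e] := ltgtP (nu (F i)) (nu (F j)).
- have [|n0 e0] := nu_add_lt Fi0 S0; rewrite ?eS //.
  exists i; split; rewrite ?mem_head // => l; rewrite inE => /predU1P[-> //|lr].
  exact: le_trans (ltW lt) (le_j _ lr).
- rewrite addrC.
  have [|n0 e0] := nu_add_lt S0 Fi0; rewrite ?eS //.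
  exists j; split; rewrite ?inE ?jr ?orbT // ?e0 // => l.
  by rewrite inE => /predU1P[->|/le_j //]; exact: ltW.
- have := inj i j; rewrite mem_head inE jr orbT => /(_ isT isT e) ij.
  by rewrite ij jr in ir.
Qed.

Variable sigma : rat.

(** Membership in the sum of the [k]-span of [B] and of the space of elements of
    value at least [sigma]. Recursion on [B] lets vectors be added one at a
    time. *)
Fixpoint span_mod (B : seq K) (f : K) : Prop :=
  if B is b :: B' then exists c, span_mod B' (f - iota c * b)
  else vge nu f sigma.

Lemma span_mod_vge B f g :
  span_mod B f -> vge nu g sigma -> span_mod B (f + g).
Proof.
elim: B f => [|b B IH] f /=; first exact: vgeD.
by move=> [c hc] hg; exists c; rewrite addrAC; apply: IH.
Qed.

Lemma span_mod_cat B1 B2 f g :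
  span_mod B1 f -> span_mod B2 g -> span_mod (B1 ++ B2) (f + g).
Proof.
elim: B1 f => [|b B IH] f /= hf hg; first by rewrite addrC; apply: span_mod_vge.
by case: hf => c hc; exists c; rewrite addrAC; apply: IH.
Qed.

Lemma span_mod_comb B c d f g :
  span_mod B f -> span_mod B g -> span_mod B (iota c * f + iota d * g).
Proof.
elim: B f g => [|b B IH] f g /=.
  by move=> hf hg; apply: vgeD; apply: vge_iotaM.
move=> [u hu] [v hv]; exists (c * u + d * v).
suff -> : iota c * f + iota d * g - iota (c * u + d * v) * b =
  iota c * (f - iota u * b) + iota d * (g - iota v * b) by apply: IH.
by rewrite rmorphD !rmorphM; ring.
Qed.

(** Each vector added to [B] brings at most one new value below [sigma]: if [f0]
    and [f] had distinct new values, eliminating [b] between them would give an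
    element of [span_mod B] whose value is the smaller of the two. *)
Lemma finite_values B : exists L : seq rat,
  forall f, span_mod B f -> f != 0 -> nu f < sigma -> nu f \in L.
Proof.
elim: B => [|b B [L hL]].
  by exists [::] => f /= [->|h]; rewrite ?eqxx // ltNge h.
have [[f0 [hf0 n0 lt0 nL]]|none] := pselect (exists f0,
  [/\ span_mod (b :: B) f0, f0 != 0, nu f0 < sigma & nu f0 \notin L]); last first.
  exists L => f hf f0 lt_f; apply: contrapT => /negP nL.
  by apply: none; exists f.
exists (nu f0 :: L) => f [d hd] f0' lt_f; rewrite inE.
case: hf0 => c hc.
apply: contrapT => /negP; rewrite negb_or => /andP[ne nfL].
have c0 : c != 0.
  by apply: contraNneq nL => c0; apply: hL; move: hc; rewrite // c0 rmorph0 mul0r subr0.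
have d0 : d != 0.
  by apply: contraNneq nfL => d0; apply: hL; move: hd; rewrite // d0 rmorph0 mul0r subr0.
pose g := iota (- c) * f + iota d * f0.
have hg : span_mod B g.
  have -> : g = iota (- c) * (f - iota d * b) + iota d * (f0 - iota c * b).
    by rewrite /g !rmorphN; ring.
  exact: span_mod_comb.
have nc0 : - c != 0 by rewrite oppr_eq0.
have e1 := nu_iotaM f nc0; have e2 := nu_iotaM f0 d0.
have z1 : iota (- c) * f != 0 by rewrite mulf_neq0 // fmorph_eq0.
have z2 : iota d * f0 != 0 by rewrite mulf_neq0 // fmorph_eq0.
have [lt|lt|e] := ltgtP (nu f) (nu f0); last by rewrite e eqxx in ne.
- have [|g0 eg] := nu_add_lt z1 z2; rewrite ?e1 ?e2 //.
  by move: nfL; rewrite -e1 -eg hL // eg e1.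
- have [|g0 eg] := nu_add_lt z2 z1; rewrite ?e1 ?e2 //.
  by move: nL; rewrite -e2 -eg hL // ?eg ?e2 // addrC.
Qed.

End Valuations.

(** * Generated ideals *)

Section IdealGen.
Variables (K : fieldType) (R : set K) (A : set K).
Hypothesis hR : subring R.

Lemma subring0 : R 0.
Proof. by case: hR => h1 hB _; rewrite -(subrr 1); apply: hB. Qed.

Lemma subringN a : R a -> R (- a).
Proof. by case: hR => h1 hB _ ha; rewrite -sub0r; apply/hB/ha/subring0. Qed.

Lemma subringD a b : R a -> R b -> R (a + b).
Proof.
by case: hR => h1 hB _ ha hb; rewrite -(opprK b); apply/hB/subringN.
Qed.

Lemma subringM a b : R a -> R b -> R (a * b).
Proof. by case: hR => _ _ hM; apply: hM. Qed.

Lemma subring1 : R 1.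
Proof. by case: hR. Qed.

Lemma subringX a n : R a -> R (a ^+ n).
Proof.
by move=> ha; elim: n => [|n IH]; [exact: subring1|rewrite exprS; apply: subringM].
Qed.

Lemma ideal_gen0 : ideal_gen R A 0.
Proof. by exists 0%N, (fun _ => 0), (fun _ => 0); split=> [[]//|]; rewrite big_ord0. Qed.

Lemma ideal_genM r g : R r -> A g -> ideal_gen R A (r * g).
Proof.
by move=> hr hg; exists 1%N, (fun _ => r), (fun _ => g); rewrite big_ord1.
Qed.

Lemma ideal_genD f g : ideal_gen R A f -> ideal_gen R A g -> ideal_gen R A (f + g).
Proof.
move=> [n1 [r1 [g1 [h1 ->]]]] [n2 [r2 [g2 [h2 ->]]]].
exists (n1 + n2)%N,
  (fun i => match split i with inl j => r1 j | inr j => r2 j end),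
  (fun i => match split i with inl j => g1 j | inr j => g2 j end); split.
  by move=> i; case: (split i).
rewrite big_split_ord /=; congr (_ + _); apply: eq_bigr => i _.
  by rewrite (unsplitK (inl i)).
by rewrite (unsplitK (inr i)).
Qed.

Lemma ideal_gen_mulr r f : R r -> ideal_gen R A f -> ideal_gen R A (r * f).
Proof.
move=> hr [n [c [g [h ->]]]]; exists n, (fun i => r * c i), g; split.
  by move=> i; case: (h i) => h1 h2; split=> //; apply: subringM.
by rewrite mulr_sumr; apply: eq_bigr => i _; rewrite mulrA.
Qed.

End IdealGen.

(** * Groups and semigroups of values *)

Section Spans.
Implicit Types (w : nat -> rat) (A B : set rat).

Definition subgroup A : Prop := A 0 /\ forall a b, A a -> A b -> A (a - b).

Section Subgroup.
Variable A : set rat.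
Hypothesis hA : subgroup A.

Lemma subgroupN a : A a -> A (- a).
Proof. by case: hA => h0 hB ha; rewrite -sub0r; apply: hB. Qed.

Lemma subgroupD a b : A a -> A b -> A (a + b).
Proof. by case: hA => h0 hB ha hb; rewrite -(opprK b); apply/hB/subgroupN. Qed.

Lemma subgroupB a b : A a -> A b -> A (a - b).
Proof. by case: hA => _; apply. Qed.

Lemma subgroupMn a n : A a -> A (a *+ n).
Proof.
move=> ha; elim: n => [|n IH]; first by case: hA.
by rewrite mulrS; apply: subgroupD.
Qed.

Lemma subgroupMz a (e : int) : A a -> A (a *~ e).
Proof.
move=> ha; case: e => n; rewrite ?NegzE ?mulrNz -?pmulrn; first exact: subgroupMn.
exact/subgroupN/subgroupMn.
Qed.

(** Division with remainder: the remainder would be a smaller multiple. *)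
Lemma least_multiple_dvd g n (e : int) :
    is_least [set e | (0 < e)%N /\ A (g *+ e)] n -> A (g *~ e) ->
  exists e', e = n%:Z * e'.
Proof.
move=> [[n0 hn] min_n] he; exists (e %/ n%:Z)%Z.
have n0' : n%:Z != 0 by rewrite eqz_nat -lt0n.
have [r er] : exists r : nat, (e %% n%:Z)%Z = r%:Z.
  by exists `|(e %% n%:Z)%Z|%N; rewrite gez0_abs // modz_ge0.
case: (posnP r) => [r0|r0].
  by rewrite {1}(divz_eq e n%:Z) er r0 addr0 mulrC.
have := ltz_pmod e (_ : 0 < n%:Z); rewrite er ltz_nat => /(_ n0).
rewrite ltnNge min_n //; split=> //.
have -> : g *+ r = g *~ e - (g *+ n) *~ (e %/ n%:Z)%Z.
  rewrite {1}(divz_eq e n%:Z) mulrzDr er pmulrn (pmulrn g n) -mulrzA.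
  by rewrite (mulrC n%:Z) addrAC subrr add0r.
by apply/subgroupB/subgroupMz.
Qed.

Lemma least_multiple_eq g n (a b : nat) :
    is_least [set e | (0 < e)%N /\ A (g *+ e)] n -> A (g *~ (a%:Z - b%:Z)) ->
  (a < n)%N -> (b < n)%N -> a = b.
Proof.
move=> hn /(least_multiple_dvd hn)[e' eab] lt_a lt_b.
have [e0|[e1|e1]] : e' = 0 \/ (1 <= e' \/ e' <= -1) by lia.
- by move: eab; rewrite e0 mulr0; lia.
- by have : n%:Z * 1 <= n%:Z * e' by [rewrite ler_wpM2l]; lia.
- by have : n%:Z * e' <= n%:Z * -1 by [rewrite ler_wpM2l]; lia.
Qed.

End Subgroup.

Lemma zspanP n w g :
  zspan n w g <-> exists c : nat -> int, g = \sum_(j < n) w j *~ c j.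
Proof.
split=> [[c ->]|[c ->]]; last by exists (fun j => c j).
exists (fun j => if insub j is Some i then c i else 0).
by apply: eq_bigr => i _; rewrite valK.
Qed.

Lemma zspan_subgroup n w : subgroup (zspan n w).
Proof.
split; first by exists (fun _ => 0); rewrite big1.
move=> _ _ [c ->] [d ->]; exists (fun j => c j - d j).
by rewrite -sumrB; apply: eq_bigr => j _; rewrite mulrzBr.
Qed.

Lemma zspan_mono n n' w g : (n <= n')%N -> zspan n w g -> zspan n' w g.
Proof.
move=> le_n /zspanP[c ->]; apply/zspanP.
exists (fun j => if (j < n)%N then c j else 0).
rewrite (big_ord_widen _ (fun j => w j *~ c j) le_n) big_mkcond.
by apply: eq_bigr => j _; case: ifP.
Qed.

Lemma zspanS n w g :
  zspan n.+1 w g <-> exists h e, zspan n w h /\ g = h + w n *~ e.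
Proof.
split=> [/zspanP[c ->]|[h [e [/zspanP[c ->] ->]]]].
  by exists (\sum_(j < n) w j *~ c j), (c n); rewrite big_ord_recr; split=> //; exists (fun j => c j).
apply/zspanP; exists (fun j => if (j < n)%N then c j else e).
rewrite big_ord_recr /= ltnn; congr (_ + _).
by apply: eq_bigr => j _; rewrite ltn_ord.
Qed.

Lemma sum_mulrzB w n (a b : nat -> nat) :
  \sum_(j < n) w j *~ ((a j)%:Z - (b j)%:Z) =
  \sum_(j < n) w j *+ a j - \sum_(j < n) w j *+ b j.
Proof. by rewrite -sumrB; apply: eq_bigr => j _; rewrite mulrzBr. Qed.

Lemma sumset_subgroup A B : subgroup A -> subgroup B -> subgroup (sumset A B).
Proof.
move=> [a0 hA] [b0 hB]; split; first by exists 0, 0; rewrite addr0.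
move=> _ _ [a [b [ha hb ->]]] [a' [b' [ha' hb' ->]]].
by exists (a - a'), (b - b'); split; [exact: hA|exact: hB|rewrite opprD addrACA].
Qed.

Lemma bigcup_subgroup (F : nat -> set rat) :
    (forall i, subgroup (F i)) -> (forall i j, (i <= j)%N -> F i `<=` F j) ->
  subgroup (\bigcup_i F i).
Proof.
move=> hF mono; split; first by exists 0%N => //; case: (hF 0%N).
move=> a b [i _ ha] [j _ hb]; exists (maxn i j) => //.
apply: subgroupB; first exact: hF.
  exact: mono (leq_maxl _ _) _ ha.
exact: mono (leq_maxr _ _) _ hb.
Qed.

End Spans.

(** * Irreducible monomials are determined by their values *)

Local Notation mono := ({cmonom symb}).
Local Notation psym j := (@inl nat nat j : symb).
Local Notation tsym j := (@inr nat nat j : symb).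

Section Windows.
Variables (K : fieldType) (nu : K -> rat) (P T : nat -> K).
Let beta := jbeta nu P.
Let gamma := jgamma nu T.

(** The families [T] start at [T_1], so the symbol [T_0] has no meaning. *)
Definition T0free (w : mono) : Prop := w (tsym 0%N) = 0%N.

Lemma mono_in_T0free a b w : mono_in a b w -> T0free w.
Proof.
by move=> h; apply/eqP; rewrite monalg.cmE_eq0; apply/negP => /h.
Qed.

Lemma T0free_mul w w' : T0free w -> T0free w' -> T0free (monalg.mmul w w').
Proof. by rewrite /T0free mmulE => -> ->. Qed.

Lemma T0free_le b w : mono_le b w -> T0free w -> T0free b.
Proof. by rewrite /T0free => le_b pw; have := le_b (tsym 0%N); rewrite pw leqn0 => /eqP. Qed.

Lemma T0free_mono_in w : T0free w ->
  exists N, forall a b, (N <= a)%N -> (N <= b)%N -> mono_in a b w.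
Proof.
move=> pw; pose idx (u : symb) := match u with inl j => j | inr j => j end.
exists (\max_(u <- finsupp w) (idx u).+1)%N => a b le_a le_b u uw.
have lt_u : (idx u < \max_(u <- finsupp w) (idx u).+1)%N.
  by rewrite (big_rem u uw) /= leq_maxl.
case: u uw lt_u => j jw /= lt_j; first exact: leq_trans le_a.
rewrite (leq_trans lt_j le_b) andbT lt0n; apply: contraTneq jw => ->.
by rewrite -monalg.cmE_eq0 pw.
Qed.

Lemma mono_weight_window a b w : mono_in a b.+1 w ->
  mono_weight (jweight nu P T) w =
  \sum_(j < a) beta j *+ w (psym j) +
  \sum_(j < b) gamma j.+1 *+ w (tsym j.+1).
Proof.
move=> hw; pose r := [seq (psym j) | j <- iota 0 a] ++
                     [seq (tsym j) | j <- iota 1 b].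
have -> : mono_weight (jweight nu P T) w = \sum_(u <- r) jweight nu P T u *+ w u.
  apply: (@mono_big_widen _ _ _ _ (fun u e => jweight nu P T u *+ e)) => //.
    rewrite cat_uniq !map_inj_uniq ?iota_uniq ?andbT /=; try by move=> i j [].
    by apply/hasPn => _ /mapP[j _ ->]; apply/negP => /mapP[].
  move=> u /hw; rewrite mem_cat; case: u => j lt_j.
    by rewrite map_f // mem_iota.
  by rewrite orbC map_f // mem_iota add1n.
have ie c : iota 0 c = index_iota 0 c by rewrite /index_iota subn0.
by rewrite big_cat !big_map /= (iotaDl 1 0) big_map !ie !big_mkord.
Qed.

End Windows.

Section Uniqueness.
Variables (k K : fieldType) (iota : {rmorphism k -> K}) (nu : K -> rat).
Variables (P T : nat -> K).
Variables (q : nat -> nat) (n : nat -> mono) (lam : nat -> k).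
Variables (s m : nat -> nat) (D : nat -> seq (mono * nat)).
Variables (l : nat -> mono * nat -> mono) (mu : nat -> mono * nat -> k).
Let beta := jbeta nu P.
Let gamma := jgamma nu T.
Let G := jG nu P.
Let H := jH nu T.
Let Gall := jGall nu P.
Let weight := mono_weight (jweight nu P T).

Hypothesis hP : forall i, (0 < i)%N -> P_step iota nu P T q n lam i.
Hypothesis hT : forall i, (0 < i)%N -> T i != 0 ->
  T_step iota nu P T q s m D l mu i.
Hypothesis hT0 : forall i, (0 < i)%N -> T i = 0 -> T_step_zero s m D i.
Hypothesis beta0_gt0 : 0 < beta 0%N.

Definition Tsetall : set mono := \bigcup_i Tset T q s D i.

Let Gsub i : subgroup (G i). Proof. exact: zspan_subgroup. Qed.
Let Hsub i : subgroup (H i). Proof. exact: zspan_subgroup. Qed.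
Let Gmono i j : (i <= j)%N -> G i `<=` G j.
Proof. by move=> le_ij g; apply: zspan_mono. Qed.
Let Gallsub : subgroup Gall. Proof. exact: bigcup_subgroup. Qed.
Let GGall i : G i `<=` Gall. Proof. by move=> g hg; exists i. Qed.

Lemma m_nondecreasing i : (m i <= m i.+1)%N.
Proof.
have [T0|T0] := eqVneq (T i.+1) 0.
  by have [_ -> _] := hT0 (ltn0Sn i) T0.
by have [_ [j _ ->] _ _ _] := hT (ltn0Sn i) T0; apply: leq_maxl.
Qed.

(** Since [q_j beta_j] is the first multiple of [beta_j] in [G_(j-1)], two
    exponents of the last [P_j] that are below [q_j] and congruent modulo
    [G_(j-1)] are equal; then descend. *)
Lemma beta_digits (r N : nat) (a a' : nat -> nat) :
    G r (\sum_(j < N) beta j *~ ((a j)%:Z - (a' j)%:Z)) ->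
    (forall j, (r < j < N)%N -> (a j < q j)%N /\ (a' j < q j)%N) ->
  forall j, (r < j < N)%N -> a j = a' j.
Proof.
elim: N => [|N IH] hG lt_q j /andP[rj jN]; first by [].
have rN : (r < N)%N by lia.
have [hq _ _ _] := hP (leq_ltn_trans (leq0n r) rN).
have [|aN aN'] := lt_q N; first by rewrite rN ltnSn.
rewrite big_ord_recr /= in hG.
have eN : a N = a' N.
  apply: (least_multiple_eq _ hq) => //.
  have -> : beta N *~ ((a N)%:Z - (a' N)%:Z) =
    (\sum_(j < N) beta j *~ ((a j)%:Z - (a' j)%:Z) +
     beta N *~ ((a N)%:Z - (a' N)%:Z)) -
    \sum_(j < N) beta j *~ ((a j)%:Z - (a' j)%:Z) by rewrite addrAC subrr add0r.
  apply: (subgroupB (Gsub _)); first by apply: Gmono hG; lia.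
  apply/zspanP; exists (fun j => (a j)%:Z - (a' j)%:Z).
  by rewrite prednK //; lia.
have [->//|jN'] := eqVneq j N; apply: IH; last by lia.
  by move: hG; rewrite eN subrr mulr0z addr0.
by move=> i ?; apply: lt_q; lia.
Qed.

(** By the choice of [s_i], the coefficient of [gamma_i] in an element of [G] is
    a multiple of [s_i]; as [s_i gamma_i] lies in [H_(i-1) + G_(m_i)], the
    elements [gamma_i, gamma_(i-1), ..] can be eliminated in turn. *)
Lemma HG_cap_G i r g : (m i <= r)%N -> sumset (H i) (G r) g -> Gall g -> G r g.
Proof.
elim: i g => [|i IH] g le_r [h [g' [hh hg ->]]] hGall.
  by case: hh => c ->; rewrite big_ord0 add0r.
have [h' [e [hh' eh]]] := (zspanS i _ h).1 hh.
have le_r' : (m i <= r)%N by apply: leq_trans (m_nondecreasing i) le_r.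
have [T0|T0] := eqVneq (T i.+1) 0.
  apply: IH => //; exists h', g'; split=> //.
  by rewrite eh /jgamma T0 eqxx mul0rz addr0.
have [hs [j hj em] _ _ _] := hT (ltn0Sn i) T0.
have [e' ee] : exists e', e = (s i.+1)%:Z * e'.
  apply: (least_multiple_dvd _ hs); first exact: sumset_subgroup.
  exists (- h'), (h' + gamma i.+1 *~ e); split; last by rewrite addrA addNr add0r.
    exact: subgroupN.
  have -> : h' + gamma i.+1 *~ e = h + g' - g' by rewrite addrK eh.
  by apply: subgroupB => //; apply: GGall hg.
have [[h1 [g1 [hh1 hg1 e1]]] _] := hj.
apply: IH => //; exists (h' + h1 *~ e'), (g1 *~ e' + g'); split.
- by apply: subgroupD => //; apply: subgroupMz.
- apply: subgroupD => //; apply: subgroupMz => //.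
  by apply: Gmono hg1; apply: leq_trans le_r; rewrite em leq_maxr.
- rewrite eh ee mulrzA -pmulrn -/gamma.
  by rewrite [gamma _ *+ _]e1 mulrzDl !addrA.
Qed.

Lemma irreducible_P w j : irreducible_wrt Tsetall w -> (0 < j)%N ->
  (w (psym j) < q j)%N.
Proof.
move=> irr j0; rewrite ltnNge; apply/negP => le_q.
apply: (irr (mono_mulXn (psym j) (q j) (monalg.onecm _))).
  move=> u; rewrite mono_mulXnE monalg.onecmE addn0.
  by case: eqP => [<-|_]; rewrite ?mul1n ?mul0n.
by exists 0%N => //; left; exists j.+1 => //; exists j => //; rewrite j0 /=.
Qed.

(** At the last [T_i] whose exponents differ, the tuple formed by the part of [w]
    of index at most [m_i] in the [P_j] and less than [i] in the [T_j], and by the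
    difference of the exponents of [T_i] divided by [s_i], has its value in
    [S_(m_i) + U_(i-1)]. A reduced tuple below it gives a forbidden monomial
    dividing [w]. *)
Lemma no_collision w w' i :
    T0free w -> T0free w' ->
    irreducible_wrt Tsetall w -> irreducible_wrt Tsetall w' ->
    weight w = weight w' ->
    (forall j, (i < j)%N -> w (tsym j) = w' (tsym j)) ->
  ~ (w' (tsym i) < w (tsym i))%N.
Proof.
move=> pw pw' irr irr' ew eqj lt_w.
have i0 : (0 < i)%N.
  by rewrite lt0n; apply: contraTneq lt_w => ->; rewrite pw.
have T0 : T i != 0.
  apply/eqP => T0; apply: (irr (monalg.ucm (tsym i))).
    by move=> u; rewrite monalg.ucmE; case: eqP => [<-|_] //; apply: leq_ltn_trans lt_w.
  by exists i.+1 => //; right; exists i; rewrite ?i0 ?ltnSn //= T0 eqxx.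
have [hs [j hj em] [_ hD _] _ _] := hT i0 T0.
case: i i0 T0 lt_w eqj hs hj em hD => [//|i] _ T0 lt_w eqj hs hj em hD.
have [N1 hN1] := T0free_mono_in pw; have [N2 hN2] := T0free_mono_in pw'.
pose N := (maxn (maxn N1 N2) (maxn (m i.+1).+1 i.+1))%N.
have NM : ((m i.+1).+1 <= N)%N by rewrite /N; lia.
have iN : (i.+1 <= N)%N by rewrite /N; lia.
have in_w : mono_in N N.+1 w by apply: hN1; rewrite /N; lia.
have in_w' : mono_in N N.+1 w' by apply: hN2; rewrite /N; lia.
(* From here on [i.+1] is the last index. Equality of the values expresses
   [gamma i.+1 *~ e] as [h + g], with [h] in [H i] and [g] in [Gall]. *)
pose e := (w (tsym i.+1) - w' (tsym i.+1))%N.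
have e0 : (0 < e)%N by rewrite subn_gt0.
pose a j := w (psym j); pose a' j := w' (psym j).
pose c j := w (tsym j); pose c' j := w' (tsym j).
pose g := \sum_(j < N) beta j *~ ((a' j)%:Z - (a j)%:Z).
pose h := \sum_(j < i) gamma j.+1 *~ ((c' j.+1)%:Z - (c j.+1)%:Z).
have eX : gamma i.+1 *~ e%:Z = h + g.
  have split_sum (b : nat -> nat) : \sum_(j < N) gamma j.+1 *+ b j.+1 =
     \sum_(j < i) gamma j.+1 *+ b j.+1 + gamma i.+1 *+ b i.+1 +
     \sum_(i.+1 <= j < N) gamma j.+1 *+ b j.+1.
    rewrite -(big_mkord xpredT (fun j => gamma j.+1 *+ b j.+1)).
    by rewrite (@big_cat_nat _ _ _ i.+1) //= big_nat_recr // big_mkord.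
  move: ew; rewrite /weight (mono_weight_window _ _ _ in_w) (mono_weight_window _ _ _ in_w').
  rewrite -/beta -/gamma (split_sum c) (split_sum c').
  have -> : \sum_(i.+1 <= j < N) gamma j.+1 *+ c j.+1 =
            \sum_(i.+1 <= j < N) gamma j.+1 *+ c' j.+1.
    by apply: eq_big_nat => t /andP[it _]; rewrite /c /c' eqj.
  rewrite /h /g sum_mulrzB.
  rewrite (sum_mulrzB (fun j => gamma j.+1) i (fun j => c' j.+1) (fun j => c j.+1)).
  have -> : e%:Z = (c i.+1)%:Z - (c' i.+1)%:Z by rewrite subzn // ltnW.
  by rewrite mulrzBr -!pmulrn => e1; lra.
have hh : H i h by apply/zspanP; exists (fun j => (c' j.+1)%:Z - (c j.+1)%:Z).
have hg : Gall g.
  by apply: (GGall (i := N.-1)); apply/zspanP; exists (fun j => (a' j)%:Z - (a j)%:Z);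
     rewrite prednK //; lia.
have [e' ee] : exists e', e%:Z = (s i.+1)%:Z * e'.
  by apply: (least_multiple_dvd _ hs); [exact: sumset_subgroup|exists h, g].
have [[s0 _] _] := hs.
have [e1 {}ee e10] : exists2 e1 : nat, e = (s i.+1 * e1)%N & (0 < e1)%N.
  by exists `|e'|%N; nia.
have [[h1 [g1 [hh1 hg1 es]]] _] := hj.
have m_j : (j <= m i.+1)%N by rewrite em leq_maxr.
(* As [s i.+1] divides [e], [g] also lies in the sum of [H i] and
   [G (m i.+1)]. *)
have hg' : G (m i.+1) g.
  apply: (@HG_cap_G i) => //; first exact: m_nondecreasing.
  exists (h1 *~ e1%:Z - h), (g1 *~ e1%:Z); split.
  - by apply: subgroupB => //; apply: subgroupMz.
  - by apply: subgroupMz => //; apply: Gmono hg1.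
  - have -> : g = gamma i.+1 *~ e%:Z - h by rewrite eX; ring.
    rewrite ee PoszM mulrzA -pmulrn -pmulrn [gamma _ *+ _]es pmulrn mulrzDl.
    by rewrite addrAC.
have eqa : forall j, (m i.+1 < j < N)%N -> a j = a' j.
  move=> t tN; apply/esym; apply: (beta_digits hg') tN => t' lt_t'.
  by split; apply: irreducible_P => //; lia.
(* Only the symbols entering the tuples of stage [i.+1] are kept. *)
pose pr (u : symb) := match u with inl j => (j < (m i.+1).+1)%N
                                 | inr j => (0 < j < i.+1)%N end.
have in_restr v : mono_in (m i.+1).+1 i.+1 (mono_restr pr v).
  by move=> u; rewrite mono_finsuppP mono_restrE /pr; case: u => t; case: ifP.
have sum_restr v : weight (mono_restr pr v) =
    \sum_(j < (m i.+1).+1) beta j *+ v (psym j) +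
    \sum_(j < i) gamma j.+1 *+ v (tsym j.+1).
  rewrite /weight (mono_weight_window _ _ _ (in_restr v)).
  by congr (_ + _); apply: eq_bigr => t _; rewrite mono_restrE /= ?ltn_ord ?ltnS ?ltn_ord.
have e_restr : weight (mono_restr pr w) + (gamma i.+1 *+ s i.+1) *+ e1 =
               weight (mono_restr pr w').
  rewrite !sum_restr -mulrnA -ee pmulrn eX.
  have -> : g = \sum_(j < (m i.+1).+1) beta j *~ ((a' j)%:Z - (a j)%:Z).
    rewrite /g -!(big_mkord xpredT (fun j => beta j *~ ((a' j)%:Z - (a j)%:Z))).
    rewrite (@big_cat_nat _ _ _ (m i.+1).+1) //= [X in _ + X = _]big_nat_cond.
    rewrite [X in _ + X = _]big1 ?addr0 // => t; rewrite andbT => tN.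
    by rewrite eqa // subrr mulr0z.
  rewrite /h sum_mulrzB.
  rewrite (sum_mulrzB (fun j => gamma j.+1) i (fun j => c' j.+1) (fun j => c j.+1)).
  by rewrite /a /a' /c /c'; ring.
have Phi_restr v : sumset (jS nu P (m i.+1)) (jU nu T i) (weight (mono_restr pr v)).
  rewrite sum_restr; exists (\sum_(j < (m i.+1).+1) beta j *+ v (psym j)).
  exists (\sum_(j < i) gamma j.+1 *+ v (tsym j.+1)); split=> //.
    by exists (fun j => v (psym j)).
  by exists (fun j => v (tsym j.+1)).
have := Phi_restr w'; rewrite -e_restr => Phi_e.
have [b [e2 [le_b /andP[e20 e21] red]]] := reduced_below e10 Phi_e.
have le_bw : mono_le b w.
  by move=> u; apply: leq_trans (le_b u) _; rewrite mono_restrE; case: ifP.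
have bD : (b, e2) \in D i.+1.
  apply/hD; split=> //=.
    move=> u ub; apply: in_restr; move: ub; rewrite !mono_finsuppP.
    by rewrite -!lt0n => /leq_trans; apply; apply: le_b.
  move=> b' le_b' hb'; apply: (irr b').
    by move=> u; apply: leq_trans (le_b' u) (le_bw u).
  by exists i.+1.
apply: (irr (tuple_mono s i.+1 (b, e2))).
  move=> u; rewrite /tuple_mono mono_mulXnE /=.
  have [<-|_] := eqVneq (tsym i.+1) u; last by rewrite mul0n add0n.
  have := le_b (tsym i.+1); rewrite mono_restrE /= ltnn leqn0 => /eqP ->.
  rewrite mul1n addn0; apply: (@leq_trans e); last exact: leq_subr.
  by rewrite ee mulnC leq_mul2l e21 orbT.
exists i.+2 => //; right; exists i.+1; first by rewrite /= ltnSn.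
by rewrite (negPf T0); exists (b, e2).
Qed.

(** By [no_collision], applied in both directions from the last [T_j] down, the
    exponents of the [T_j] agree; those of the [P_j] are then equal as digits. *)
Lemma irreducible_weight_inj w w' :
    T0free w -> T0free w' ->
    irreducible_wrt Tsetall w -> irreducible_wrt Tsetall w' ->
  weight w = weight w' -> w = w'.
Proof.
move=> pw pw' irr irr' ew.
have [N1 hN1] := T0free_mono_in pw; have [N2 hN2] := T0free_mono_in pw'.
pose N := (maxn (maxn N1 N2) 1)%N.
have in_w : mono_in N N.+1 w by apply: hN1; rewrite /N; lia.
have in_w' : mono_in N N.+1 w' by apply: hN2; rewrite /N; lia.
have eqT t : (forall j, (t <= j)%N -> w (tsym j) = w' (tsym j)) ->
    forall j, w (tsym j) = w' (tsym j).
  elim: t => [|t IH] heq j; first exact: heq.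
  apply: IH => {}j; rewrite leq_eqVlt => /predU1P[<-|]; last exact: heq.
  have [lt|lt|//] := ltngtP (w (tsym t)) (w' (tsym t)).
    by case: (no_collision pw' pw irr' irr (esym ew) _ lt) => j' /heq.
  by case: (no_collision pw pw' irr irr' ew _ lt) => j' /heq.
have {}eqT j : w (tsym j) = w' (tsym j).
  apply: (eqT N.+1) => {}j le_j.
  have out v : mono_in N N.+1 v -> v (tsym j) = 0%N.
    by move=> hv; apply/eqP; rewrite monalg.cmE_eq0; apply/negP => /hv; lia.
  by rewrite !out.
have e0 : \sum_(j < N) beta j *~ ((w (psym j))%:Z - (w' (psym j))%:Z) = 0.
  move: ew; rewrite /weight (mono_weight_window _ _ _ in_w) (mono_weight_window _ _ _ in_w').
  have -> : \sum_(j < N) jgamma nu T j.+1 *+ w (tsym j.+1) =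
            \sum_(j < N) jgamma nu T j.+1 *+ w' (tsym j.+1).
    by apply: eq_bigr => j _; rewrite eqT.
  move=> /addIr /eqP; rewrite -subr_eq0 -sumrB => /eqP e1; rewrite -[RHS]e1.
  by apply: eq_bigr => j _; rewrite mulrzBr.
(* [beta_digits] says nothing of the exponent of [P_0], which is recovered
   afterwards from [beta_0 <> 0]. *)
have eqP1 j : (0 < j < N)%N -> w (psym j) = w' (psym j).
  apply: (@beta_digits 0 N (fun j => w (psym j)) (fun j => w' (psym j))).
    by rewrite e0; case: (Gsub 0).
  by move=> t /andP[t0 _]; split; apply: irreducible_P.
have eq_psym j : (j < N)%N -> w (psym j) = w' (psym j).
  case: j => [_|j jN]; last exact: eqP1.
  move: e0; have [M eM] : exists M, N = M.+1 by exists N.-1; rewrite /N; lia.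
  move: eqP1; rewrite eM => eqP1; rewrite big_ord_recl big1 => [|j _].
    by move/eqP; rewrite addr0 mulrz_eq0 (gt_eqF beta0_gt0) orbF /=; lia.
  by rewrite eqP1 ?subrr ?mulr0z // lift0 /= ltnS ltn_ord.
apply: mono_ext; case=> j //.
have [jN|jN] := ltnP j N; first exact: eq_psym.
have out v : mono_in N N.+1 v -> v (psym j) = 0%N.
  by move=> hv; apply/eqP; rewrite monalg.cmE_eq0; apply/negP => /hv; lia.
by rewrite !out.
Qed.

End Uniqueness.

(** * Rewriting monomials by the jumping polynomials *)

(** Every iterate of [F] from the [i.+1]-st on has the right value at [i]. *)
Lemma course_of_values (F : (nat -> nat) -> nat -> nat) :
    (forall r r' i, (forall j, (j < i)%N -> r j = r' j) -> F r i = F r' i) ->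
  exists r, forall i, r i = F r i.
Proof.
move=> ext; pose it N := iter N F (fun _ => 0%N).
have stable N : forall M i, (i < N)%N -> (N <= M)%N -> it M i = it N i.
  elim: N => [//|N IH] [//|M] i lt_i le_N; apply: ext => j lt_j.
  by apply: IH; lia.
exists (fun i => it i.+1 i) => i; apply: ext => j lt_j.
by apply: stable.
Qed.

Lemma ltn_count_sub (A : eqType) (a b : pred A) v (L : seq A) :
  subpred a b -> v \in L -> b v -> ~~ a v -> (count a L < count b L)%N.
Proof.
move=> sub vL bv av; have -> : count b L = (count a L + count (predD b a) L)%N.
  elim: {vL} L => //= u L ->; have := @sub u.
  by rewrite /predD /=; case: (a u); case: (b u) => //=; lia.
rewrite -[X in (X < _)%N]addn0 ltn_add2l -has_count.
by apply/hasP; exists v => //=; rewrite /predD /= av.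
Qed.

Lemma vgt0_bound (K : fieldType) (nu : K -> rat) a : vgt nu a 0 ->
  exists2 e, 0 < e & forall e', e' <= e -> vge nu a e'.
Proof.
move=> [->|h]; first by exists 1 => // e' _; left.
by exists (nu a) => // e' le_e; right.
Qed.

Lemma semigroup_genP (A B : set rat) :
    B 0 -> (forall a b, B a -> B b -> B (a + b)) -> A `<=` B ->
  semigroup_gen A `<=` B.
Proof.
move=> B0 BD AB _ [r hr ->]; elim: r hr => [|a r IH] hr; first by rewrite big_nil.
rewrite big_cons; apply: BD; first by apply/AB/hr/mem_head.
by apply: IH => b br; apply: hr; rewrite inE br orbT.
Qed.

Lemma semigroup_gen_sum (A : set rat) n (w : nat -> rat) (c : 'I_n -> nat) :
  (forall i, A (w i)) -> semigroup_gen A (\sum_(j < n) w j *+ c j).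
Proof.
move=> Aw; have D a b : semigroup_gen A a -> semigroup_gen A b -> semigroup_gen A (a + b).
  move=> [r hr ->] [r' hr' ->]; exists (r ++ r'); last by rewrite big_cat.
  by move=> u; rewrite mem_cat => /orP[/hr|/hr'].
have Z : semigroup_gen A 0 by exists [::] => //; rewrite big_nil.
elim/big_ind: _ => // j _; elim: (c j) => [//|e IH]; rewrite mulrS; apply: D => //.
by exists [:: w j]; rewrite ?big_seq1 // => a; rewrite inE => /eqP ->.
Qed.

(** The data of the construction, and what is used of [R]: it is a subring
    between [k] and the valuation ring, and each of its elements is a constant
    plus an element of the ideal generated by [x], [y], [z], whose values are
    positive. *)
Section Rewriting.
Variables (k K : fieldType) (iota : {rmorphism k -> K}) (nu : K -> rat).
Variables (R : set K) (x y z : K) (P T : nat -> K).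
Variables (q : nat -> nat) (n : nat -> mono) (lam : nat -> k).
Variables (s m : nat -> nat) (D : nat -> seq (mono * nat)).
Variables (l : nat -> mono * nat -> mono) (mu : nat -> mono * nat -> k).
Hypothesis hnu : is_valuation iota nu.
Hypothesis hP : P_construction iota nu x y P T q n lam.
Hypothesis hT : T_construction iota nu z P T q s m D l mu.
Hypothesis hR : subring R.
Hypothesis hkR : range iota `<=` R.
Hypothesis hRV : R `<=` val_ring nu.
Hypothesis hxyz : [/\ R x, R y & R z].
Hypothesis hpos : [/\ vgt nu x 0, vgt nu y 0 & vgt nu z 0].
Hypothesis hdec : forall f, R f -> exists c f1 f2 f3,
  [/\ R f1, R f2, R f3 & f = iota c + f1 * x + f2 * y + f3 * z].

Implicit Types (w b : mono) (u t : symb).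

Let ev := mono_eval (jpoly P T).
Let weight := mono_weight (jweight nu P T).
Let Tset_all := Tsetall T q s D.

Let hPs i : (0 < i)%N -> P_step iota nu P T q n lam i.
Proof. by case: hP => _ _; apply. Qed.
Let hTs i : (0 < i)%N -> T i != 0 -> T_step iota nu P T q s m D l mu i.
Proof. by case: hT => _ _ H _ _; apply: H. Qed.
Let hTz i : (0 < i)%N -> T i = 0 -> T_step_zero s m D i.
Proof. by case: hT => _ _ _ H _; apply: H. Qed.

(** A nonzero residue says that [f] and [iota c * g] have the same initial form,
    so that their difference has larger value; in particular [f / 0] has no such
    residue. *)
Lemma residue_vgt f g c : c != 0 -> residue_is iota nu (f / g) c ->
  [/\ f != 0, g != 0 & vgt nu (f - iota c * g) (nu g)].
Proof.
move=> c0 [_ hc].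
have fg0 : f / g != 0.
  apply/eqP => fg0; case: hc; rewrite fg0 sub0r.
    by move/eqP; rewrite oppr_eq0 fmorph_eq0 (negPf c0).
  by rewrite (nuN hnu) (nu_iota hnu) // ltxx.
have [f0 g0] : f != 0 /\ g != 0.
  by move: fg0; rewrite mulf_eq0 invr_eq0 negb_or => /andP.
split=> //; have -> : f - iota c * g = (f / g - iota c) * g.
  by rewrite mulrBl divfK.
have [->|d0] := eqVneq (f / g - iota c) 0; first by left; rewrite mul0r.
case: hc => [/eqP|hc]; first by rewrite (negPf d0).
by right; rewrite (nuM hnu) // ltrDr.
Qed.

(** If [x] were zero, the monomial [P_0 ^+ n_(1,0)] subtracted from [y ^+ q_1]
    could have a nonzero evaluation only for [n_(1,0) = 0], against
    [q_1 nu(y) > 0]. *)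
Lemma P_neq0 i : P i != 0.
Proof.
have nz j : (0 < j)%N -> P j != 0.
  move=> j0; have [[[q0 _] _] _ [l0 hr] _] := hPs j0.
  have [+ _ _] := residue_vgt l0 hr.
  by rewrite expf_eq0 q0.
case: i => [|i]; last exact: nz.
have [[[q0 _] _] [n_in e_n _] [l0 hr] _] := hPs (ltn0Sn 0).
have [_ ev0 _] := residue_vgt l0 hr.
apply: (iffLR (mono_eval_neq0 _ _) ev0 (psym 0%N)); apply/eqP => n0.
have n1 : n 1%N = monalg.onecm _.
  apply: mono_ext => u; rewrite monalg.onecmE; apply/eqP; rewrite monalg.cmE_eq0.
  apply/negP => un; have := n_in u un; case: u un => j un; last by rewrite ltn0 andbF.
  by case: j un => // un _; rewrite -monalg.cmE_neq0 n0 eqxx in un.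
have [_ P1 _] := hP; have [_ + _] := hpos; rewrite -P1 => -[/eqP|ypos].
  by rewrite (negPf (nz _ _)).
by move: e_n; rewrite n1 mono_weight_one => /eqP; rewrite mulrn_eq0 !gt_eqF.
Qed.

Lemma beta0_gt0 : 0 < jbeta nu P 0%N.
Proof.
have [P0 _ _] := hP; have [+ _ _] := hpos; rewrite /jbeta -P0 => -[/eqP|//].
by rewrite (negPf (P_neq0 _)).
Qed.

Lemma iota_R c : R (iota c).
Proof. by apply: hkR; exists c. Qed.

Lemma ev_R w : (forall u, u \in finsupp w -> R (jpoly P T u)) -> R (ev w).
Proof.
move=> hw; rewrite /ev /mono_eval big_seq.
elim/big_ind: _ => [|f g|u]; [exact: subring1|exact: subringM|].
by move=> /hw; apply: subringX.
Qed.

Lemma P_R i : R (P i).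
Proof.
have [P0 P1 _] := hP; have [Rx Ry _] := hxyz.
elim/ltn_ind: i => -[|[|i]] IH; rewrite ?P0 ?P1 //.
have [_ [n_in _ _] _ ->] := hPs (ltn0Sn i).
apply: subringD => //; first by apply: subringX => //; apply: IH.
apply: subringN => //; apply: subringM => //; first exact: iota_R.
apply: ev_R => -[] j /n_in; last by rewrite ltn0 andbF.
by move=> lt_j; apply: IH; apply: ltnW.
Qed.

(** The stages before [i] produce the elements up to some [T_r], and [T_i = 0] if
    [r < i]. Hence the stage [i] producing a nonzero [T_t] with [t > 1] satisfies
    [i < t], and [T_t] is a polynomial in elements of smaller index. *)
Lemma T_R (t : nat) : (0 < t)%N -> R (T t).
Proof.
have [T1 _ _ _ Tstop] := hT; have [_ _ Rz] := hxyz.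
elim/ltn_ind: t => t IH t0; pose r i := (\sum_(j < i) jdelta D j)%N.
have [->|Tt0] := eqVneq (T t) 0; first exact: subring0.
have [->|t1] := eqVneq t 1%N; first by rewrite T1.
(* [i] is the stage producing [T_t]: the first one after which [r] reaches [t]. *)
have ex_r : exists i, (t <= r i)%N.
  by exists t; rewrite leqNgt; apply/negP => /(Tstop _ t0)/eqP; rewrite (negPf Tt0).
case: (ex_minnP ex_r) => -[|i]; first by rewrite /r big_ord0; lia.
move=> le_t min_i; have lt_r : (r i < t)%N.
  by rewrite ltnNge; apply/negP => /min_i; rewrite ltnn.
have i0 : (0 < i)%N.
  by case: (i) le_t => [|//]; rewrite /r big_ord_recr big_ord0 /jdelta /=; lia.
move: le_t; rewrite /r big_ord_recr /= -/(r i) {1}/jdelta eqn0Ngt i0 /= => le_t.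
have Ti0 : T i != 0.
  by apply/eqP => /(hTz i0)[_ _ Di]; rewrite Di /= in le_t; lia.
have it : (i < t)%N.
  by rewrite ltnNge; apply/negP => ti; case/eqP: Ti0; apply: Tstop => //; apply: leq_trans ti.
have [_ _ [_ hD _] hl hTe] := hTs i0 Ti0.
have [e lt_e te] : exists2 e, (e < size (D i))%N & t = (r i + e.+1)%N.
  by exists (t - r i).-1; lia.
have := hTe e lt_e; rewrite -/(r i) -te /= => ->.
set d := nth _ _ _; have dD : d \in D i by apply: mem_nth.
have Rin w (b : nat) : (b <= t)%N -> mono_in (m i).+1 b w -> R (ev w).
  move=> le_b w_in; apply: ev_R => -[] j /w_in /=; first by move=> _; apply: P_R.
  by move=> /andP[j0 jb]; apply: IH => //; apply: leq_trans le_b.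
have [d_in _ _ _] := (hD d).1 dD; have [l_in _ _ _ _] := hl d dD.
apply: subringD => //.
  rewrite /tuple_mono mono_eval_mulXn /=; apply: subringM => //.
    by apply: subringX => //; apply: IH.
  by apply: (Rin _ i) => //; apply: ltnW.
apply: subringN => //; apply: subringM => //; first exact: iota_R.
by apply: (Rin _ i) => //; apply: ltnW.
Qed.

Lemma jpoly_R u : u != tsym 0%N -> R (jpoly P T u).
Proof.
case: u => j /=; first by move=> _; apply: P_R.
by case: j => [/eqP//|j _]; apply: T_R.
Qed.

Lemma T0free_supp w u : T0free w -> u \in finsupp w -> u != tsym 0%N.
Proof.
by move=> pw; rewrite mono_finsuppP; apply: contraNneq => ->; rewrite pw.
Qed.

Lemma T0free_R w : T0free w -> R (ev w).
Proof. by move=> pw; apply: ev_R => u uw; apply/jpoly_R/(T0free_supp pw). Qed.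

Lemma nu_ev w : ev w != 0 -> nu (ev w) = weight w.
Proof.
move=> /mono_eval_neq0 hw; rewrite /ev /weight /mono_eval /mono_weight.
have {}hw : forall u, u \in enum_fset (finsupp w) -> jpoly P T u != 0.
  by move=> u; rewrite mono_finsuppP; apply: hw.
suff [_ ->] : \prod_(u <- finsupp w) jpoly P T u ^+ w u != 0 /\
  nu (\prod_(u <- finsupp w) jpoly P T u ^+ w u) =
  \sum_(u <- finsupp w) nu (jpoly P T u) *+ w u.
  apply: eq_big_seq => u /hw; case: u => j //= Tj.
  by rewrite /jgamma (negPf Tj).
elim: (enum_fset (finsupp w)) hw => [|u r IH] hw.
  by rewrite !big_nil oner_neq0 (nu1 hnu).
have hu : jpoly P T u != 0 by apply/hw/mem_head.
have u0 : jpoly P T u ^+ w u != 0 by apply: expf_neq0.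
have [|r0 er] := IH; first by move=> v vr; apply: hw; rewrite inE vr orbT.
by rewrite !big_cons mulf_neq0 // (nuM hnu) // er (nuX hnu).
Qed.

(** The monomials [n i] and [l i d] involve only symbols earlier than [P_i] and
    [T_i] respectively, every [P_j] counting as earlier than [T_i]; so the ranks
    of the symbols can be chosen in turn, first those of the [P_i]. *)
Lemma exists_rank : exists rk : symb -> nat,
  (forall i, (0 < i)%N -> (mono_rank rk (n i) < rk (psym i))%N) /\
  (forall i, (0 < i)%N -> T i != 0 -> forall d, d \in D i ->
     (mono_rank rk (l i d) < rk (tsym i))%N).
Proof.
pose pk (r : nat -> nat) (u : symb) := if u is inl j then r j else 0%N.
have [|rP hrP] := @course_of_values (fun r i =>
    if (0 < i)%N then (mono_rank (pk r) (n i)).+1 else 0%N).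
  move=> r r' i err; case: ifP => // i0; congr S; apply: eq_mono_rank => u.
  have [_ [n_in _ _] _ _] := hPs i0; case: u => j /n_in //=; exact: err.
pose tk (r : nat -> nat) (u : symb) := match u with inl j => rP j | inr j => r j end.
have [|rT hrT] := @course_of_values (fun r i =>
    if (0 < i)%N && (T i != 0) then
      (\sum_(d <- D i) mono_rank (tk r) (l i d)).+1 else 0%N).
  move=> r r' i err; case: ifP => // /andP[i0 Ti0]; congr S.
  have [_ _ _ hl _] := hTs i0 Ti0.
  apply: eq_big_seq => d /hl[l_in _ _ _ _]; apply: eq_mono_rank => u.
  by case: u => j /l_in //= /andP[_]; exact: err.
exists (tk rT); split=> [i i0|i i0 Ti0 d dD] /=.
  rewrite hrP i0 ltnS eq_leq //; apply: eq_mono_rank => u.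
  by have [_ [n_in _ _] _ _] := hPs i0; case: u => j /n_in; rewrite ?ltn0 ?andbF.
by rewrite hrT i0 Ti0 ltnS (big_rem d) //= leq_addr.
Qed.

(** A forbidden monomial that does not evaluate to 0 is the leading monomial of
    a jumping polynomial [t]; [b'] is the monomial subtracted in its
    construction. *)
Lemma reduction (rk : symb -> nat) b :
    (forall i, (0 < i)%N -> (mono_rank rk (n i) < rk (psym i))%N) ->
    (forall i, (0 < i)%N -> T i != 0 -> forall d, d \in D i ->
       (mono_rank rk (l i d) < rk (tsym i))%N) ->
    Tset_all b -> ev b != 0 ->
  exists c b' t, [/\ T0free b', weight b' = weight b,
    (mono_rank rk b' < mono_rank rk b)%N,
    ev b = jpoly P T t + iota c * ev b' &
    t != tsym 0%N /\ (jpoly P T t != 0 -> weight b < jweight nu P T t)].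
Proof.
move=> rkP rkT [i _ [[j _ [t /andP[t0 _] ->]]|[j /andP[j0 _] hb]]] ev0.
  have [[[q0 _] _] [n_in e_n _] [l0 hr] eP] := hPs t0.
  have [f0 g0 hgt] := residue_vgt l0 hr.
  exists (lam t), (n t), (psym t.+1); split.
  - exact: mono_in_T0free n_in.
  - by rewrite /weight -e_n mono_weight_mulXn mono_weight_one addr0.
  - rewrite mono_rank_mulXn; apply: (leq_trans (rkP t t0)).
    by rewrite (leq_trans _ (leq_addr _ _)) // leq_pmulr.
  - by rewrite /ev mono_eval_mulXn mono_eval_one mulr1 /= eP subrK.
  - split=> //= P0; rewrite /weight mono_weight_mulXn mono_weight_one addr0 /= e_n.
    rewrite -/weight -nu_ev // /jbeta eP.
    by case: hgt => [/eqP|//]; rewrite -eP (negPf P0).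
case: eqVneq hb => [Tj0 eb|Tj0 [d dD eb]].
  move/mono_eval_neq0: ev0 => /(_ (tsym j)).
  by rewrite eb monalg.ucmE eqxx /= Tj0 eqxx => /(_ isT).
have [[[s0 _] _] _ [_ hD _] hl hTe] := hTs j0 Tj0.
have [d_in d0 _ _] := (hD d).1 dD; have [l_in e_l _ m0 hr] := hl d dD.
have [f0 g0 hgt] := residue_vgt m0 hr.
have := hTe (index d (D j)); rewrite index_mem nth_index //= => /(_ dD) eT.
exists (mu j d), (l j d), (tsym (\sum_(i < j) jdelta D i + (index d (D j)).+1)%N).
have ew : tuple_weight nu P T s j d = weight b.
  by rewrite eb /weight /tuple_mono mono_weight_mulXn addrC.
split.
- exact: mono_in_T0free l_in.
- by rewrite -ew.
- rewrite eb /tuple_mono mono_rank_mulXn; apply: (leq_trans (rkT j j0 Tj0 d dD)).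
  by rewrite (leq_trans _ (leq_addr _ _)) // leq_pmulr // muln_gt0 d0.
- by rewrite eb /= eT subrK.
- split=> /=; first by rewrite addnS; apply/eqP => -[].
  rewrite /jgamma eT => nz; rewrite (negPf nz) -ew e_l -/weight -nu_ev //.
  by case: hgt => [/eqP|//]; rewrite (negPf nz).
Qed.

(** * Normal forms modulo the monomials of large value *)

Lemma exists_eps : exists2 e, 0 < e & [/\ vge nu x e, vge nu y e & vge nu z e].
Proof.
have [/vgt0_bound[e1 p1 h1] /vgt0_bound[e2 p2 h2] /vgt0_bound[e3 p3 h3]] := hpos.
exists (Num.min e1 (Num.min e2 e3)); first by rewrite !lt_min p1 p2.
by split; [apply: h1|apply: h2|apply: h3]; rewrite !ge_min lexx ?orbT.
Qed.

Section NormalForms.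
Variable sigma : rat.

Definition Jgen : set K :=
  [set f | exists b : mono, f = mono_eval (jumping_family P T) b /\ vge nu f sigma].
Let J := ideal_gen R Jgen.

Lemma J_sub f : J f -> R f /\ vge nu f sigma.
Proof.
have family_R b : R (mono_eval (jumping_family P T) b).
  rewrite /mono_eval; elim/big_ind: _ => [|f' g'|u _].
  - exact: subring1.
  - exact: subringM.
  - by apply: subringX => //; case: u => j /=; [exact: P_R|exact: T_R].
move=> [N [r [g [h ->]]]]; split.
  elim/big_ind: _ => [|a b|i _]; [exact: subring0|exact: subringD|].
  by case: (h i) => Rr [b [-> _]]; apply: subringM.
apply: (vge_sum hnu) => i; case: (h i) => /hRV Vr [b [_ hb]].
by rewrite -[sigma]add0r; apply: (vgeM hnu).
Qed.

Lemma T0free_family w : T0free w ->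
  exists b, ev w = mono_eval (jumping_family P T) b.
Proof.
move=> pw; rewrite /ev {1}/mono_eval big_seq; elim/big_ind: _ => [|f g|u uw].
- by exists (monalg.onecm _); rewrite mono_eval_one.
- by move=> [b ->] [b' ->]; exists (monalg.mmul b b'); rewrite mono_eval_mul.
- pose v : symb := match u with inl j => inl j | inr j => inr j.-1 end.
  exists (mono_mulXn v (w u) (monalg.onecm _)).
  rewrite mono_eval_mulXn mono_eval_one mulr1; congr (_ ^+ _).
  by have := T0free_supp pw uw; rewrite /v; case: (u) => [//|[]].
Qed.

Lemma J_ev r w : R r -> T0free w -> vge nu (ev w) sigma -> J (r * ev w).
Proof.
move=> Rr pw hw; apply: ideal_genM => //.
by have [b eb] := T0free_family pw; exists b.
Qed.

Definition normal w : Prop :=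
  [/\ T0free w, irreducible_wrt Tset_all w & ev w != 0].

Definition has_normal_form f : Prop :=
  exists r : seq (k * mono), (forall p, p \in r -> normal p.2) /\
    J (f - \sum_(p <- r) iota p.1 * ev p.2).

Lemma normal_form_J f : J f -> has_normal_form f.
Proof. by exists [::]; rewrite big_nil subr0. Qed.

Lemma normal_formD f g :
  has_normal_form f -> has_normal_form g -> has_normal_form (f + g).
Proof.
move=> [r [hr Jr]] [r' [hr' Jr']]; exists (r ++ r'); split.
  by move=> p; rewrite mem_cat => /orP[/hr|/hr'].
by rewrite big_cat opprD addrACA; apply: ideal_genD.
Qed.

Lemma normal_formZ c f : has_normal_form f -> has_normal_form (iota c * f).
Proof.
move=> [r [hr Jr]]; exists [seq (c * p.1, p.2) | p <- r]; split.
  by move=> _ /mapP[p /hr ? ->].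
rewrite big_map (_ : _ - _ = iota c * (f - \sum_(p <- r) iota p.1 * ev p.2)).
  by apply: ideal_gen_mulr => //; apply: iota_R.
rewrite mulrBr mulr_sumr; congr (_ - _); apply: eq_bigr => p _.
by rewrite rmorphM mulrA.
Qed.

(** Splitting off the residue of [f], [f * M] is a multiple of [M] plus elements
    of [R x M + R y M + R z M]; the values of [x M], [y M], [z M] are closer to
    [sigma] by at least [e]. *)
Lemma span_R M N e : R M -> [/\ vge nu x e, vge nu y e & vge nu z e] ->
    vge nu M (sigma - e *+ N) ->
  exists B, forall f, R f -> span_mod iota nu sigma B (f * M).
Proof.
move=> RM he; have [Rx Ry Rz] := hxyz; elim: N M RM => [|N IH] M RM hM.
  exists [::] => f Rf /=; rewrite -[sigma]add0r; apply: (vgeM hnu); first exact: hRV.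
  by move: hM; rewrite mulr0n subr0.
have step a : R a -> vge nu a e ->
    exists B, forall f, R f -> span_mod iota nu sigma B (f * (a * M)).
  move=> Ra ha; apply: IH; first exact: subringM.
  have -> : sigma - e *+ N = e + (sigma - e *+ N.+1) by rewrite mulrS; ring.
  exact: (vgeM hnu).
have [hx hy hz] := he.
have [Bx hBx] := step x Rx hx; have [By hBy] := step y Ry hy.
have [Bz hBz] := step z Rz hz.
exists (M :: Bx ++ By ++ Bz) => f /hdec[c [f1 [f2 [f3 [R1 R2 R3 ->]]]]].
exists c; rewrite -/(span_mod iota nu sigma _ _).
have -> : (iota c + f1 * x + f2 * y + f3 * z) * M - iota c * M =
  f1 * (x * M) + (f2 * (y * M) + f3 * (z * M)) by ring.
apply: (span_mod_cat hnu); first exact: hBx.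
by apply: (span_mod_cat hnu); [exact: hBy|exact: hBz].
Qed.

Lemma eps_bound e : 0 < e -> exists N, sigma - e *+ N <= 0.
Proof.
move=> e0; exists (Num.bound (`|sigma| / e)).
have := archi_boundP (divr_ge0 (normr_ge0 sigma) (ltW e0)).
rewrite ltr_pdivrMr // mulr_natl => /ltW h.
by rewrite subr_le0; apply: le_trans h; apply: ler_norm.
Qed.

Lemma finitely_many_values :
  exists L : seq rat, forall f, R f -> f != 0 -> nu f < sigma -> nu f \in L.
Proof.
have [e e0 he] := exists_eps; have [N hN] := eps_bound e0.
have [||B hB] := @span_R 1 N e _ he; first exact: subring1.
  by right; rewrite (nu1 hnu).
have [L hL] := finite_values hnu sigma B; exists L => f Rf.
by apply: hL; rewrite -[f]mulr1; apply: hB.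
Qed.

(** Lexicographic induction on the number of values between that of [w] and
    [sigma], and on the rank of [w]: the two monomials given by [reduction]
    decrease the first, or keep it and decrease the second. *)
Lemma monomial_normal_form w : T0free w -> has_normal_form (ev w).
Proof.
have [rk [rkP rkT]] := exists_rank; have [L hL] := finitely_many_values.
pose cnt w := count (fun v => weight w <= v) L.
move: {2}(cnt w).+1 (ltnSn (cnt w)) => N; elim: N w => [//|N IHN] w.
move: {2}(mono_rank rk w).+1 (ltnSn (mono_rank rk w)) => M.
elim: M w => [//|M IHM] w lt_M lt_N pw.
have [ev0|ev0] := eqVneq (ev w) 0.
  by rewrite ev0; apply/normal_form_J/ideal_gen0.
have [le_s|lt_s] := leP sigma (nu (ev w)).
  apply: normal_form_J; rewrite -[ev w]mul1r; apply: J_ev => //.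
    exact: subring1.
  by right.
have wL : weight w \in L by rewrite -nu_ev // hL //; apply: T0free_R.
have [irr|red] := pselect (irreducible_wrt Tset_all w).
  exists [:: (1, w)]; split; first by move=> p; rewrite inE => /eqP ->.
  by rewrite big_seq1 rmorph1 mul1r subrr; apply: ideal_gen0.
have [b [le_b hb]] : exists b, mono_le b w /\ Tset_all b.
  by apply: contrapT => no; apply: red => b le_b hb; apply: no; exists b.
set u := monalg.divcm w b; have ew : w = monalg.mmul b u by apply: mono_leK.
have pu : T0free u.
  by apply: T0free_le pw => v; rewrite ew mmulE leq_addl.
have evM : ev w = ev b * ev u by rewrite ew /ev mono_eval_mul.
have [evb0 evu0] : ev b != 0 /\ ev u != 0.
  by move: ev0; rewrite evM mulf_eq0 negb_or => /andP.
have [c [b' [t [pb' wb' rb' evb [t0 wt]]]]] := reduction rkP rkT hb evb0.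
have ww : weight w = weight b + weight u by rewrite ew /weight mono_weight_mul.
have -> : ev w = ev (mono_mulXn t 1 u) + iota c * ev (monalg.mmul b' u).
  by rewrite evM evb /ev mono_eval_mulXn mono_eval_mul expr1; ring.
apply: normal_formD.
  have [->|evt0] := eqVneq (ev (mono_mulXn t 1 u)) 0.
    exact/normal_form_J/ideal_gen0.
  have wlt : weight w < weight (mono_mulXn t 1 u).
    rewrite ww /weight mono_weight_mulXn mulr1n ltrD2r; apply: wt.
    by move: evt0; rewrite /ev mono_eval_mulXn expr1 mulf_eq0 negb_or => /andP[].
  apply: IHN; last first.
    by rewrite /T0free mono_mulXnE pu (negPf t0) mul0n.
  apply: (@leq_trans (cnt w)); last by rewrite -ltnS.
  apply: (@ltn_count_sub _ _ _ (weight w)) => //=.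
    by move=> v /=; apply: le_trans (ltW wlt).
  by rewrite -ltNge.
apply: normal_formZ; apply: IHM.
- by rewrite mono_rank_mul; move: lt_M; rewrite ew mono_rank_mul; lia.
- by rewrite /cnt /weight mono_weight_mul -/weight wb' -ww.
- exact: T0free_mul.
Qed.

(** The recursion of [span_R] again, now tracking the monomials. *)
Lemma normal_form_mul N w e : T0free w ->
    [/\ vge nu x e, vge nu y e & vge nu z e] ->
    vge nu (ev w) (sigma - e *+ N) ->
  forall f, R f -> has_normal_form (f * ev w).
Proof.
move=> pw he; elim: N w pw => [|N IH] w pw hw f Rf.
  by apply/normal_form_J/J_ev => //; move: hw; rewrite mulr0n subr0.
have step t a : t != tsym 0%N -> jpoly P T t = a -> vge nu a e ->
    forall g, R g -> has_normal_form (g * (a * ev w)).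
  move=> t0 ta ha g Rg.
  have e1 : a * ev w = ev (mono_mulXn t 1 w).
    by rewrite /ev mono_eval_mulXn expr1 ta.
  rewrite e1; apply: IH => //; first by rewrite /T0free mono_mulXnE pw (negPf t0) mul0n.
  rewrite -e1; have -> : sigma - e *+ N = e + (sigma - e *+ N.+1).
    by rewrite mulrS; ring.
  exact: (vgeM hnu).
have [c [f1 [f2 [f3 [R1 R2 R3 ->]]]]] := hdec Rf.
have -> : (iota c + f1 * x + f2 * y + f3 * z) * ev w =
  iota c * ev w + (f1 * (x * ev w) + (f2 * (y * ev w) + f3 * (z * ev w))) by ring.
have [P0 P1 _] := hP; have [T1 _ _ _ _] := hT; have [hx hy hz] := he.
apply: normal_formD; first exact/normal_formZ/monomial_normal_form.
apply: normal_formD; first exact: (step (psym 0%N)).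
by apply: normal_formD; [exact: (step (psym 1%N))|exact: (step (tsym 1%N))].
Qed.

Lemma normal_form f : R f -> has_normal_form f.
Proof.
have [e e0 he] := exists_eps; have [N hN] := eps_bound e0; move=> Rf.
have e1 : ev (monalg.onecm _) = 1 by rewrite /ev mono_eval_one.
rewrite -[f]mulr1 -e1; apply: (@normal_form_mul N _ e) => //.
  by rewrite /T0free monalg.onecmE.
by right; rewrite e1 (nu1 hnu).
Qed.

(** Terms with the same monomial are collected. *)
Lemma reduced_normal_form f : R f ->
  exists (r : seq mono) (c : mono -> k), [/\ uniq r,
    forall w, w \in r -> normal w /\ c w != 0 &
    J (f - \sum_(w <- r) iota (c w) * ev w)].
Proof.
move=> /normal_form[r [hr Jr]].
pose c w := \sum_(p <- r | p.2 == w) p.1.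
exists [seq w <- undup (map snd r) | c w != 0], c; split.
- by rewrite filter_uniq ?undup_uniq.
- move=> w; rewrite mem_filter mem_undup => /andP[c0 /mapP[p /hr np ew]].
  by split=> //; rewrite ew.
rewrite big_filter (_ : \sum_(w <- _ | _) _ = \sum_(p <- r) iota p.1 * ev p.2) //.
rewrite big_mkcond /=.
have -> : \sum_(w <- undup (map snd r)) (if c w != 0 then iota (c w) * ev w else 0) =
  \sum_(w <- undup (map snd r)) \sum_(p <- r | p.2 == w) iota p.1 * ev p.2.
  apply: eq_bigr => w _; have -> : \sum_(p <- r | p.2 == w) iota p.1 * ev p.2 =
    iota (c w) * ev w.
    by rewrite rmorph_sum mulr_suml; apply: eq_bigr => p /eqP ->.
  by case: eqP => // ->; rewrite rmorph0 mul0r.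
rewrite (exchange_big_dep xpredT) //= big_seq [RHS]big_seq.
apply: eq_bigr => p pr; rewrite (big_rem p.2) /=; last first.
  by rewrite mem_undup map_f.
rewrite eqxx big_seq_cond big1 ?addr0 // => w.
by rewrite mem_rem_uniq ?undup_uniq // inE => /andP[/andP[+ _] /eqP ew]; rewrite ew eqxx.
Qed.

(** The terms of a normal form have distinct values, so its value is the least
    of theirs. *)
Lemma normal_form_value (r : seq mono) (c : mono -> k) :
    uniq r -> (forall w, w \in r -> normal w /\ c w != 0) -> r != [::] ->
  exists w, [/\ w \in r, \sum_(w <- r) iota (c w) * ev w != 0,
    nu (\sum_(w <- r) iota (c w) * ev w) = weight w &
    forall w', w' \in r -> weight w <= weight w'].
Proof.
move=> ur hr r0.
have nuF w : w \in r -> nu (iota (c w) * ev w) = weight w.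
  by move=> /hr[[_ _ ev0] c0]; rewrite (nu_iotaM hnu) // nu_ev.
have [|||w [wr S0 eS le_w]] := @nu_sum _ _ _ _ hnu _ (fun w => iota (c w) * ev w) r ur.
- by move=> w /hr[[_ _ ev0] c0]; rewrite mulf_neq0 ?fmorph_eq0.
- move=> w w' wr wr' /=; rewrite !nuF //.
  have [[pw irr _] _] := hr w wr; have [[pw' irr' _] _] := hr w' wr'.
  exact: (irreducible_weight_inj hPs hTs hTz beta0_gt0).
- exact: r0.
exists w; split=> //; first by rewrite eS nuF.
by move=> w' wr'; rewrite -!nuF // le_w.
Qed.

Lemma val_ideal_sub_J f : R f -> vge nu f sigma -> J f.
Proof.
move=> Rf hf; have [r [c [ur hr Jr]]] := reduced_normal_form Rf.
have [r0|r0] := eqVneq r [::]; first by move: Jr; rewrite r0 big_nil subr0.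
have [w [wr S0 eS le_w]] := normal_form_value ur hr r0.
rewrite -(subrK (\sum_(w <- r) iota (c w) * ev w) f); apply: ideal_genD => //.
have hS : vge nu (\sum_(w <- r) iota (c w) * ev w) sigma.
  rewrite -[\sum_(w <- r) _](subKr f); apply: (vgeD hnu) => //.
  have [_ [e|e]] := J_sub Jr; first by left; rewrite e oppr0.
  by right; rewrite (nuN hnu).
case: hS => [/eqP|]; first by rewrite (negPf S0).
rewrite eS => le_s; rewrite big_seq; elim/big_ind: _ => [|a b|w' wr'].
- exact: ideal_gen0.
- exact: ideal_genD.
- have [[pw' _ ev0] c0] := hr w' wr'; apply: J_ev => //; first exact: iota_R.
  by right; rewrite nu_ev //; apply: le_trans (le_w _ wr').
Qed.

End NormalForms.

(** Modulo elements of value larger than [nu f], a normal form of [f] has the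
    value of [f]. *)
Lemma value_is_weight f : R f -> f != 0 -> exists2 w, T0free w & nu f = weight w.
Proof.
move=> Rf f0; have [r [c [ur hr Jr]]] := reduced_normal_form (nu f + 1) Rf.
have [_ hJ] := J_sub Jr.
have [r0|r0] := eqVneq r [::].
  move: hJ; rewrite r0 big_nil subr0 => -[/eqP|]; first by rewrite (negPf f0).
  by rewrite gerDl ler10.
have [w [wr S0 eS _]] := normal_form_value ur hr r0.
have [[pw _ _] _] := hr w wr; exists w => //; rewrite -eS.
rewrite -[\sum_(w <- r) _](subKr f).
have [|_ ->//] := @nu_add_vgt _ _ _ _ hnu f (- (f - \sum_(w <- r) iota (c w) * ev w)) f0.
case: hJ => [->|h]; first by left; rewrite oppr0.
by right; rewrite (nuN hnu); apply: lt_le_trans h; rewrite ltrDl ltr01.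
Qed.

Lemma jumping_generating_sequence :
  generating_sequence nu R (jumping_family P T).
Proof.
split=> [[] j /=|sigma _]; [exact: P_R|exact: T_R|].
apply/seteqP; split=> f; first by case; apply: val_ideal_sub_J.
by move=> /J_sub.
Qed.

Lemma jumping_value_semigroup :
  value_semigroup nu R = sumset (jSall nu P) (jUall nu T) /\
  value_semigroup nu R =
    semigroup_gen ([set b | exists i, b = jbeta nu P i] `|`
                   [set c | exists2 i, (0 < i)%N & c = jgamma nu T i]).
Proof.
set A := (_ `|` _).
have VS : value_semigroup nu R `<=` sumset (jSall nu P) (jUall nu T).
  move=> _ [f [Rf f0 ->]]; have [w pw ->] := value_is_weight Rf f0.
  have [N hN] := T0free_mono_in pw.
  have w_in : mono_in N.+1 N.+1 w by apply: hN.
  rewrite /weight (mono_weight_window _ _ _ w_in).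
  exists (\sum_(j < N.+1) jbeta nu P j *+ w (psym j)).
  exists (\sum_(j < N) jgamma nu T j.+1 *+ w (tsym j.+1)); split=> //.
    by exists N => //; exists (fun j => w (psym j)).
  by exists N => //; exists (fun j => w (tsym j.+1)).
have SA : sumset (jSall nu P) (jUall nu T) `<=` semigroup_gen A.
  move=> _ [_ [_ [[i _ [c ->]] [i' _ [c' ->]] ->]]].
  have [r hr ->] : semigroup_gen A (\sum_(j < i.+1) jbeta nu P j *+ c j).
    by apply: semigroup_gen_sum => j; left; exists j.
  have [r' hr' ->] : semigroup_gen A (\sum_(j < i') jgamma nu T j.+1 *+ c' j).
    by apply: (semigroup_gen_sum (w := fun j => jgamma nu T j.+1)) => j; right; exists j.+1.
  exists (r ++ r'); last by rewrite big_cat.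
  by move=> a; rewrite mem_cat => /orP[/hr|/hr'].
have AV : semigroup_gen A `<=` value_semigroup nu R.
  have V0 : value_semigroup nu R 0.
    by exists 1; rewrite oner_neq0 (nu1 hnu); split=> //; apply: subring1.
  apply: semigroup_genP => //.
    move=> _ _ [f [Rf f0 ->]] [g [Rg g0 ->]]; exists (f * g).
    by rewrite mulf_neq0 // (nuM hnu) //; split=> //; apply: subringM.
  move=> _ [[i ->]|[i i0 ->]].
    by exists (P i); split; [exact: P_R|exact: P_neq0|].
  rewrite /jgamma; case: eqVneq => // Ti0.
  by exists (T i); split=> //; apply: T_R.
split; apply/seteqP; split.
- exact: VS.
- exact: subset_trans SA AV.
- exact: subset_trans VS SA.
- exact: AV.
Qed.

End Rewriting.

Theorem theorem4p8 (k : closedFieldType) (K : fieldType)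
    (iota : {rmorphism k -> K}) (nu : K -> rat) (R mR : set K)
    (x y z : K) (P T : nat -> K)
    (hK : algebraic_function_field iota 3)
    (hnu : is_valuation iota nu)
    (hres : residue_field_is_base iota nu)
    (hR : regular_local_ring R mR [tuple x; y; z])
    (hkR : range iota `<=` R)
    (hfrac : fraction_field R)
    (hdom : dominates nu R mR)
    (hPT : jumping_polynomials iota nu x y z P T) :
  [/\ generating_sequence nu R (jumping_family P T),
      value_semigroup nu R = sumset (jSall nu P) (jUall nu T)
    & value_semigroup nu R =
      semigroup_gen ([set b | exists i, b = jbeta nu P i] `|`
                     [set c | exists2 i, (0 < i)%N & c = jgamma nu T i])].
Proof.
have [q [n [lam [hP [s [m [D [l [mu hT]]]]]]]]] := hPT.
have [Rsub _ _ _ [Rt mR_gen]] := hR; have [RV RM] := hdom.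
have xyz_R : [/\ R x, R y & R z] by split; apply: Rt; rewrite !inE eqxx ?orbT.
have pos a : a \in [tuple x; y; z] -> vgt nu a 0.
  move=> ha; suff : (R `&` val_max nu) a by case.
  rewrite RM mR_gen -[a]mul1r; apply: ideal_genM => //; exact: subring1.
have xyz_pos : [/\ vgt nu x 0, vgt nu y 0 & vgt nu z 0].
  by split; apply: pos; rewrite !inE eqxx ?orbT.
have dec f : R f -> exists c f1 f2 f3,
    [/\ R f1, R f2, R f3 & f = iota c + f1 * x + f2 * y + f3 * z].
  move=> Rf; have [c [_ hc]] := hres f (RV f Rf).
  have : mR (f - iota c).
    rewrite -RM; split=> //; apply: subringD => //; apply: subringN => //.
    by apply: hkR; exists c.
  rewrite mR_gen => -[N [r [g [hg eg]]]].
  have [f1 [f2 [f3 [R1 R2 R3 e]]]] : exists f1 f2 f3,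
      [/\ R f1, R f2, R f3 & \sum_i r i * g i = f1 * x + f2 * y + f3 * z].
    elim/big_ind: _ => [|a b|i _].
    - by exists 0, 0, 0; rewrite !mul0r !addr0; split=> //; apply: subring0.
    - move=> [a1 [a2 [a3 [? ? ? ->]]]] [b1 [b2 [b3 [? ? ? ->]]]].
      exists (a1 + b1), (a2 + b2), (a3 + b3).
      by split; [exact: subringD|exact: subringD|exact: subringD|ring].
    - have [Rr] := hg i; have R0 := subring0 Rsub.
      rewrite /= !inE => /or3P[] /eqP ->.
      + by exists (r i), 0, 0; split=> //; ring.
      + by exists 0, (r i), 0; split=> //; ring.
      + by exists 0, 0, (r i); split=> //; ring.
  exists c, f1, f2, f3; split=> //.
  by rewrite -!addrA [f1 * x + _]addrA -e -eg addrC subrK.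
have [e1 e2] := jumping_value_semigroup hnu hP hT Rsub hkR RV xyz_R xyz_pos dec.
split=> //.
exact: (jumping_generating_sequence hnu hP hT Rsub hkR RV xyz_R xyz_pos dec).
Qed.
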